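(* The relation $\mathbb{U}_0$ on $2^\omega$ is $\sqsubseteq_c$-minimal among non-pot$(\Pi^0_1)$ sets.
   Context: Let $\psi:\omega\to2^{<\omega}$ list finite binary sequences by increasing length and lexicographically within each length, $s_n:=\psi(n)0^{n-|\psi(n)|}$, $\mathbb{G}_0:=\{(s_n0\gamma,s_n1\gamma)\mid n\in\omega,\gamma\in2^\omega\}$, $s(\mathbb{G}_0):=\mathbb{G}_0\cup\mathbb{G}_0^{-1}$, $G_{s(\mathbb{G}_0)}:=\{(0\alpha,1\beta)\mid(\alpha,\beta)\in s(\mathbb{G}_0)\}$, $\mathbb{T}_0:=\{(\varepsilon\alpha,(1-\varepsilon)\beta)\mid\varepsilon\in2,(\alpha,\beta)\in\mathbb{G}_0\}$, $\mathbb{U}_0:=G_{s(\mathbb{G}_0)}\cup\mathbb{T}_0$. A set $E\subseteq X\times X$ ($X$ Polish) is pot$(\Pi^0_1)$ if there are finer Polish topologies $\sigma,\tau$ on $X$ making $E$ closed in $(X,\sigma)\times(X,\tau)$. $(X,A)\sqsubseteq_c(Y,B)$ means there is an injective continuous $f:X\to Y$ with $(f(x),f(y))\in B\iff(x,y)\in A$. A relation $A$ on $2^\omega$ is $\sqsubseteq_c$-minimal among non-pot$(\Pi^0_1)$ sets if it is not pot$(\Pi^0_1)$ and whenever $X$ is Polish, $S$ is a non-pot$(\Pi^0_1)$ relation on $X$ and $(X,S)\sqsubseteq_c(2^\omega,A)$, then $(2^\omega,A)\sqsubseteq_c(X,S)$. *)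

(* Defs.v *)
From HB Require Import structures.
From mathcomp Require Import all_boot all_order all_algebra.
From mathcomp Require Import all_classical all_reals all_analysis.

Set Implicit Arguments.
Unset Strict Implicit.
Unset Printing Implicit Defensive.

Import Order.TTheory GRing.Theory Num.Theory.

Local Open Scope classical_set_scope.
Local Open Scope ring_scope.

Definition is_metric (R : realType) (T : Type) (d : T -> T -> R) : Prop :=
  [/\ forall x y, 0 <= d x y,
      forall x y, d x y = 0 <-> x = y,
      forall x y, d x y = d y x &
      forall x y z, d x z <= d x y + d y z].

Definition metric_compatible (R : realType) (T : topologicalType)
    (d : T -> T -> R) : Prop :=
  forall (x : T) (A : set T),
    nbhs x A <-> exists2 e : R, 0 < e & [set y | d x y < e] `<=` A.

Definition metric_complete (R : realType) (T : topologicalType)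
    (d : T -> T -> R) : Prop :=
  forall u : nat -> T,
    (forall e : R, 0 < e -> exists N : nat, forall m n : nat,
       (N <= m)%N -> (N <= n)%N -> d (u m) (u n) < e) ->
    exists l : T, u @ \oo --> l.

Definition separable (T : topologicalType) : Prop :=
  exists2 D : set T, countable D & dense D.

(* Completeness is that of some compatible metric; the empty space is Polish. *)
Definition polish (R : realType) (T : topologicalType) : Prop :=
  separable T /\
  exists d : T -> T -> R,
    [/\ is_metric d, metric_compatible d & metric_complete d].

(* A topology on a fixed carrier X is an inhabitant of the class of
   [topologicalType] over X; [with_topology s] is X equipped with s, whatever
   topology X may already carry. *)
Definition topology_on (X : Type) : Type := Topological.axioms_ X.

Definition with_topology (X : Type) (s : topology_on X) : topologicalType :=
  @Topological.Pack X s.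

Definition finer (X : topologicalType) (s : topology_on X) : Prop :=
  forall U : set X, open U -> @open (with_topology s) U.

Definition closed_in_product (S T : topologicalType) (E : set (S * T)) : Prop :=
  closed E.

Definition pot_closed (R : realType) (X : topologicalType)
    (E : set (X * X)) : Prop :=
  exists s t : topology_on X,
    [/\ finer s, finer t,
        polish R (with_topology s), polish R (with_topology t) &
        @closed_in_product (with_topology s) (with_topology t) E].

Definition cred (X Y : topologicalType)
    (A : set (X * X)) (B : set (Y * Y)) : Prop :=
  exists f : X -> Y,
    [/\ injective f, continuous f & forall x y, B (f x, f y) <-> A (x, y)].

Definition minimal_non_pot_closed (R : realType)
    (A : set (cantor_space * cantor_space)) : Prop :=
  ~ pot_closed R A /\
  forall (X : topologicalType) (S : set (X * X)),
    polish R X -> ~ pot_closed R S -> cred S A -> cred A S.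

(* The digits 0 and 1 are [false] and [true]. *)

(* The binary words of length k in lexicographic order. *)
Fixpoint words (k : nat) : seq (seq bool) :=
  if k is k'.+1 then
    [seq false :: w | w <- words k'] ++ [seq true :: w | w <- words k']
  else [:: [::]].

(* There are more than n words of length at most n, so the default value
   of [nth] is never used. *)
Definition psi (n : nat) : seq bool :=
  nth [::] (flatten [seq words k | k <- iota 0 n.+1]) n.

Definition sword (n : nat) : seq bool :=
  psi n ++ nseq (n - size (psi n)) false.

Definition prepend (w : seq bool) (a : cantor_space) : cantor_space :=
  fun i => if (i < size w)%N then nth false w i else a (i - size w)%N.

Definition G0 : set (cantor_space * cantor_space) :=
  [set p | exists (n : nat) (c : cantor_space),
     p = (prepend (rcons (sword n) false) c, prepend (rcons (sword n) true) c)].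

Definition sG0 : set (cantor_space * cantor_space) :=
  G0 `|` [set p | G0 (p.2, p.1)].

Definition G_sG0 : set (cantor_space * cantor_space) :=
  [set p | exists a b : cantor_space,
     sG0 (a, b) /\ p = (prepend [:: false] a, prepend [:: true] b)].

Definition T0 : set (cantor_space * cantor_space) :=
  [set p | exists (e : bool) (a b : cantor_space),
     G0 (a, b) /\ p = (prepend [:: e] a, prepend [:: ~~ e] b)].

Definition U0 : set (cantor_space * cantor_space) := G_sG0 `|` T0.

(* Main.v *)
Require Import Defs.
From mathcomp Require Import all_boot all_order all_algebra.
From mathcomp Require Import all_classical all_reals all_analysis.
From HB Require Import structures.

(** Write [0a], [1a] for the sequences [a] prefixed by one digit.  If [f] reduces a
    relation [S] on a Polish space [X] to [U0], let [D] be the set of all [a] such that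
    both [0a] and [1a] are in the range of [f].  The closure of [U0] only adds the pairs
    [(0a,1a)] and [(1a,0a)], so if [D] were covered by countably many Borel
    [G0]-independent sets, making their preimages clopen would make [S] closed.
    Hence [D] is not so covered, and a dichotomy argument applied to the analytic set
    [D] gives a reduction of [G0] to itself of the form "flip bit [m k] of a fixed [y]
    whenever [x k = 1]", with [m] strictly increasing, whose values are in [D] and have
    continuously chosen witnesses in [X].  These witnesses reduce [U0] to [S].

    [U0] itself is not potentially closed because a finer Polish topology agrees with
    the usual one on a comeager set, while [(0a,1a)] is a limit of [U0] along any
    comeager set of [a]'s. *)

Set Implicit Arguments.
Unset Strict Implicit.
Unset Printing Implicit Defensive.

Local Open Scope classical_set_scope.

(** * The sequences [sword n] and the graph [G0] *)

Lemma size_mem_words k w : (w \in words k) = (size w == k).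
Proof.
elim: k w => [|k IH] [|b w] //=; rewrite ?inE // mem_cat.
  by apply/negP => /orP[] /mapP[].
have inj (c : bool) : injective (cons c) by move=> ? ? [].
rewrite eqSS -IH; case: b.
  rewrite (mem_map (inj true)) orbC; case: (w \in words k) => //=.
  by apply/negP => /mapP[].
by rewrite (mem_map (inj false)); case: (w \in words k) => //=; apply/negP => /mapP[].
Qed.

Definition word_list n := flatten [seq words k | k <- iota 0 n.+1].

Lemma word_listS n : word_list n.+1 = word_list n ++ words n.+1.
Proof. by rewrite /word_list -[n.+2]addn1 iotaD map_cat flatten_cat /= cats0. Qed.

Lemma size_word_list n : n < size (word_list n).
Proof.
elim: n => [//|n IH]; rewrite word_listS size_cat.
have : nseq n.+1 false \in words n.+1 by rewrite size_mem_words size_nseq.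
case: (words n.+1) => // a l _; rewrite /= addnS ltnS.
exact: leq_trans IH (leq_addr _ _).
Qed.

Lemma nth_word_list n p i : i < size (word_list n) ->
  nth [::] (word_list (n + p)) i = nth [::] (word_list n) i.
Proof.
move=> lin; elim: p => [|p IH]; first by rewrite addn0.
rewrite addnS word_listS nth_cat IH; case: ifP => // /negbT; rewrite -leqNgt => le.
have : size (word_list n) <= size (word_list (n + p)).
  elim: p {IH le} => [|p IH]; first by rewrite addn0.
  by rewrite addnS word_listS size_cat (leq_trans IH) ?leq_addr.
by move=> /(leq_trans lin); rewrite ltnNge le.
Qed.

Lemma mem_word_list n w : (w \in word_list n) = (size w <= n).
Proof.
elim: n => [|n IH]; last first.
  by rewrite word_listS mem_cat IH size_mem_words [in RHS]leq_eqVlt ltnS orbC.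
by rewrite /word_list /= inE; case: w.
Qed.

Lemma size_psi n : size (psi n) <= n.
Proof. by rewrite -mem_word_list mem_nth // size_word_list. Qed.

Lemma psi_surj w : exists n, psi n = w.
Proof.
have wm : w \in word_list (size w) by rewrite mem_word_list.
pose j := index w (word_list (size w)); exists j; rewrite /psi -/(word_list j).
rewrite -[RHS](nth_index [::] wm) -/j.
have [le|/ltnW le] := leqP (size w) j.
  by rewrite -(subnKC le) nth_word_list ?subnKC // index_mem.
by rewrite -[in RHS](subnKC le) nth_word_list // size_word_list.
Qed.

Lemma size_sword n : size (sword n) = n.
Proof. by rewrite size_cat size_nseq subnKC // size_psi. Qed.

Definition agree (T : Type) (N : nat) (x y : nat -> T) : Prop :=
  forall i, i < N -> x i = y i.

Lemma agree_sym T N (x y : nat -> T) : agree N x y -> agree N y x.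
Proof. by move=> h i /h. Qed.

Lemma agree_trans T N (x y z : nat -> T) : agree N x y -> agree N y z -> agree N x z.
Proof. by move=> h g i iN; rewrite h ?g. Qed.

Lemma agree_le T M N (x y : nat -> T) : M <= N -> agree N x y -> agree M x y.
Proof. by move=> MN h i iM; apply: h; apply: leq_trans iM MN. Qed.

(** The limit of a fusion sequence: [f n] is frozen below [N n], so the diagonal inherits its frozen
    digits. *)
Lemma agree_diagonal (T : Type) (N : nat -> nat) (f : nat -> nat -> T) :
  (forall n, n <= N n) -> (forall n p, agree (N n) (f (n + p)) (f n)) ->
  forall n, agree (N n) (fun i => f i.+1 i) (f n).
Proof.
move=> nN ff n i iN; have [le|/ltnW le] := leqP n i.+1.
  by rewrite -(subnKC le) ff.
by rewrite -[in RHS](subnKC le) ff //; apply: nN.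
Qed.

Lemma sword_dense (x : nat -> bool) k :
  exists n, k <= n /\ agree k x (nth false (sword n)).
Proof.
have [n wn] := psi_surj (mkseq x k).
have kn : k <= n by rewrite -[k](size_mkseq x) -wn size_psi.
exists n; split=> // i ik.
by rewrite /sword nth_cat wn size_mkseq ik nth_mkseq.
Qed.

Definition flip n (x : nat -> bool) : nat -> bool := fun i => (i == n) (+) x i.

Lemma flipK n : involutive (flip n).
Proof. by move=> x; apply/funext => i; rewrite /flip addbA addbb. Qed.

Lemma agree_flip n N x y : agree N x y -> agree N (flip n x) (flip n y).
Proof. by move=> h i iN; rewrite /flip h. Qed.

Lemma flip_agree n x : agree n (flip n x) x.
Proof. by move=> i; rewrite /flip; case: eqP => // ->; rewrite ltnn. Qed.

Definition edge n (x y : nat -> bool) : Prop :=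
  [/\ agree n x (nth false (sword n)), x n = false & y = flip n x].

Lemma G0E (x y : nat -> bool) : G0 (x, y) <-> exists n, edge n x y.
Proof.
split=> [[n [c [-> ->]]]|[n [xs xn ->]]]; exists n.
  split; rewrite /prepend.
  - move=> i li; rewrite size_rcons size_sword nth_rcons size_sword li.
    by rewrite ltnW.
  - by rewrite size_rcons size_sword leqnn nth_rcons size_sword ltnn eqxx.
  - apply/funext => i; rewrite /flip !size_rcons size_sword ltnS.
    by rewrite !nth_rcons size_sword; case: ltngtP.
exists (fun i => x (i + n.+1)); congr (_, _); apply/funext => i;
  rewrite /prepend /flip size_rcons size_sword ltnS nth_rcons size_sword.
  by case: ltngtP => // [/xs//|/subnK->//|->].
by case: ltngtP => // [/xs//|/subnK->//|->]; rewrite xn.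
Qed.

Lemma edge_irrefl n x : ~ edge n x x.
Proof. by case=> _ _ /(congr1 (@^~ n)); rewrite /flip eqxx; case: (x n). Qed.

(** * Borel and analytic sets *)

(** Closedness in the product of the Cantor space with [K -> nat], by basic neighbourhoods. A
    general countable [K] lets pairs and families of witnesses be coded without pairing functions on
    [nat]. *)
Definition closedR (K : countType) (R : (nat -> bool) -> (K -> nat) -> Prop) : Prop :=
  forall x w,
    (forall N (L : seq K), exists x' w',
       [/\ agree N x' x, {in L, w' =1 w} & R x' w']) -> R x w.

(* The Borel sets: a set is Borel iff it is decided by one value of a function
   to the Baire space with closed graph. *)
Definition codable (B : set (nat -> bool)) : Prop :=
  exists (z : (nat -> bool) -> seq nat -> nat) (V : set nat),
    closedR (fun x w => w = z x) /\ forall x, B x <-> V (z x [::]).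

Lemma codableC B : codable B -> codable (~` B).
Proof. by move=> [z [V [cz BV]]]; exists z, (~` V); split=> // x /=; rewrite BV. Qed.

Lemma codable_clopen N (B : set (nat -> bool)) :
  (forall x y, agree N x y -> B x -> B y) -> codable B.
Proof.
move=> hB; exists (fun x _ => `[< B x >] : nat), [set 1]; split; last first.
  by move=> x /=; case: asboolP.
move=> x w h; apply/funext => l.
have [x' [w' [ax wl ew]]] := h N [:: l].
rewrite -wl ?inE // ew; congr (nat_of_bool _).
by apply/asboolP/asboolP; apply: hB => //; apply: agree_sym.
Qed.

Definition cantor_lipschitz (F : (nat -> bool) -> (nat -> bool)) : Prop :=
  exists c, forall N x y, agree (N + c) x y -> agree N (F x) (F y).

Lemma lipschitz_flip n : cantor_lipschitz (flip n).
Proof. by exists 0 => N x y; rewrite addn0; apply: agree_flip. Qed.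

Lemma closedR_preim F (K : countType) (R : _ -> (K -> nat) -> Prop) :
  cantor_lipschitz F -> closedR R -> closedR (fun x => R (F x)).
Proof.
move=> [c Fc] cR x w h; apply: cR => N L.
by have [x' [w' [ax wl r]]] := h (N + c) L; exists (F x'), w'; split=> //; apply: Fc.
Qed.

Lemma codable_preim F B : cantor_lipschitz F -> codable B -> codable (F @^-1` B).
Proof.
move=> FL [z [V [cz BV]]]; exists (z \o F), V; split; last by move=> x; apply: BV.
exact: (closedR_preim FL cz).
Qed.

(** The code of [x] for the union keeps the code for [B j] below [j :: l] and stores at [[::]] the
    successor of the least [j] with [B j x], or 0 if there is none. The graph stays closed because
    membership in [B j] is visible at the entry [[:: j]]. *)
Lemma codable_bigcup (B : nat -> set (nat -> bool)) :
  (forall j, codable (B j)) -> codable (\bigcup_j B j).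
Proof.
move=> /choice[z /choice[V zV]].
pose least_spec x n := (n = 0 /\ forall j, ~ B j x) \/
  exists j, [/\ n = j.+1, B j x & forall i, i < j -> ~ B i x].
have least_uniq x n p : least_spec x n -> least_spec x p -> n = p.
  case=> [[-> h]|[j [-> Bj hj]]] [[-> g]|[k [-> Bk hk]]] //.
  - by case: (h k).
  - by case: (g j).
  - by case: (ltngtP j k) => [/hk|/hj|->].
have [least leastP] : {least & forall x, least_spec x (least x)}.
  apply: choice => x; have [[j Bj]|nB] := pselect (exists j, B j x); last first.
    by exists 0; left; split=> // j Bj; apply: nB; exists j.
  have ex : exists j, `[< B j x >] by exists j; apply/asboolP.
  case: (ex_minnP ex) => k /asboolP Bk mink; exists k.+1; right; exists k; split=> // i ik Bi.
  by have := mink i (asboolT Bi); rewrite leqNgt ik.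
exists (fun x l => if l is j :: l' then z j x l' else least x), [set n | n <> 0].
split; last first.
  move=> x /=; case: (leastP x) => [[-> h]|[j [-> Bj _]]]; split=> //.
    by move=> [j _ /h].
  by exists j.
move=> x w h.
have zx j : (fun l => w (j :: l)) = z j x.
  have [cz _] := zV j; apply: (cz x) => N L.
  have [x' [w' [ax wl e]]] := h N (map (cons j) L).
  exists x', (z j x'); split=> // l lL.
  by rewrite -(wl (j :: l)) ?e // map_f.
apply/funext => -[|j l]; last by rewrite -zx.
apply: (least_uniq x) => //.
have app n : exists2 x', least x' = w [::] & forall j, j <= n -> B j x' <-> B j x.
  have [x' [w' [ax wl e]]] := h 0 ([::] :: [seq [:: j] | j <- iota 0 n.+1]).
  exists x' => [|j jn]; first by rewrite -wl ?inE // e.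
  have [_ BV] := zV j; rewrite !BV -zx -(wl [:: j]) ?e // inE map_f ?orbT //.
  by rewrite mem_iota.
case ew : (w [::]) => [|j].
  left; split=> // j Bj; have [x' lx Bx] := app j; rewrite ew in lx.
  by case: (leastP x') => [[_ /(_ j)]|[k []]]; rewrite ?lx // Bx.
right; exists j; have [x' lx Bx] := app j; rewrite ew in lx.
case: (leastP x') => [[]|[k []]]; rewrite lx // => -[<-] Bj hj; split=> //.
  by rewrite -Bx.
by move=> i ij; rewrite -Bx ?(ltnW ij) //; apply: hj.
Qed.

Lemma codable_bigcap (B : nat -> set (nat -> bool)) :
  (forall j, codable (B j)) -> codable (\bigcap_j B j).
Proof.
move=> cB; rewrite -[X in codable X]setCK setC_bigcap; apply: codableC.
by apply: codable_bigcup => j; apply: codableC.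
Qed.

Lemma codable_setI B C : codable B -> codable C -> codable (B `&` C).
Proof.
move=> cB cC; have := @codable_bigcap (fun j => if j is 0 then B else C).
rewrite (_ : \bigcap_j _ = B `&` C); first by apply=> -[].
by apply/seteqP; split=> [x h|x [Bx Cx] [|j] _ //]; split; [apply: (h 0)|apply: (h 1)].
Qed.

Definition analytic (A : set (nat -> bool)) : Prop :=
  exists (K : countType) (R : (nat -> bool) -> (K -> nat) -> Prop),
    closedR R /\ forall x, A x <-> exists w, R x w.

Lemma analytic_preim F A : cantor_lipschitz F -> analytic A -> analytic (F @^-1` A).
Proof.
move=> FL [K [R [cR AR]]]; exists K, (fun x => R (F x)); split; last by move=> x; apply: AR.
exact: closedR_preim.
Qed.

(** A witness is one for [A] together with the code of [x] for [B]; non-membership in [B] is then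
    read off one entry. *)
Lemma analytic_setD A B : analytic A -> codable B -> analytic (A `\` B).
Proof.
move=> [K [R [cR AR]]] [z [V [cz BV]]].
exists (K + seq nat)%type,
  (fun x w => [/\ R x (w \o inl), w \o inr = z x & ~ V (w (inr [::]))]).
split=> [x w h|x]; last first.
  split=> [[/AR[w r] /BV nV]|[w [r e nV]]].
    by exists (fun k => match k with inl k => w k | inr l => z x l end); split.
  split; first by apply/AR; exists (w \o inl).
  by rewrite BV -e.
split.
- apply: cR => N L; have [x' [w' [ax wl [r _ _]]]] := h N (map inl L).
  by exists x', (w' \o inl); split=> // k kL; apply: wl; rewrite map_f.
- apply: (cz x) => N L; have [x' [w' [ax wl [_ e _]]]] := h N (map inr L).
  by exists x', (w' \o inr); split=> // k kL; apply: wl; rewrite map_f.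
- have [x' [w' [_ wl [_ _]]]] := h 0 [:: inr [::]].
  by rewrite wl // inE.
Qed.

(** * Separation of analytic sets *)

Lemma dependent_choice_nat (S : Type) (Q : nat -> S -> Prop) (T : nat -> S -> S -> Prop) s0 :
  Q 0 s0 -> (forall k s, Q k s -> exists s', Q k.+1 s' /\ T k s s') ->
  exists st : nat -> S, st 0 = s0 /\ forall k, Q k (st k) /\ T k (st k) (st k.+1).
Proof.
move=> Q0 step.
have /choice[f fP] : forall p : nat * S, exists s', Q p.1 p.2 ->
    Q p.1.+1 s' /\ T p.1 p.2 s'.
  move=> [k s]; have [/step[s' h]|nQ] := pselect (Q k s); first by exists s'.
  by exists s0 => /nQ.
pose st := nat_rect (fun=> S) s0 (fun k s => f (k, s)).
have Qst k : Q k (st k) by elim: k => //= k /(fP (k, _))[].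
by exists st; split=> // k; split=> //; have [] := fP (k, st k) (Qst k).
Qed.

Definition codable_sep (A A' : set (nat -> bool)) : Prop :=
  exists B, [/\ codable B, A `<=` B & A' `<=` ~` B].

Lemma codable_sepC A A' : codable_sep A A' -> codable_sep A' A.
Proof.
move=> [B [cB AB A'B]]; exists (~` B); split=> //; first exact: codableC.
by rewrite setCK.
Qed.

Lemma codable_sep_bigcup (I : countType) (A : I -> set (nat -> bool)) A' :
  (forall i, codable_sep (A i) A') -> codable_sep (\bigcup_i A i) A'.
Proof.
move=> /choice[B hB].
exists (\bigcup_n (if unpickle n is Some i then B i else set0)); split.
- apply: codable_bigcup => n; case: unpickle => [i|]; first by have [] := hB i.
  by apply: (@codable_clopen 0).
- move=> x [i _ Aix]; exists (pickle i) => //; rewrite pickleK.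
  by have [_ AB _] := hB i; apply: AB.
- move=> x A'x [n _]; case: unpickle => // i; have [_ _ A'B] := hB i.
  exact: A'B.
Qed.

Definition prefix_agree (K : countType) k (w w' : K -> nat) : Prop :=
  forall i, pickle i < k -> w i = w' i.

Definition piece (K : countType) (R : (nat -> bool) -> (K -> nat) -> Prop) k
    (p : (nat -> bool) * (K -> nat)) : set (nat -> bool) :=
  [set x | agree k x p.1 /\ exists w, prefix_agree k w p.2 /\ R x w].

Definition refines (K : countType) k (p p' : (nat -> bool) * (K -> nat)) : Prop :=
  agree k p'.1 p.1 /\ prefix_agree k p'.2 p.2.

Definition update (K : countType) k (p : (nat -> bool) * (K -> nat)) (bn : bool * nat) :
    (nat -> bool) * (K -> nat) :=
  (fun i => if i == k then bn.1 else p.1 i,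
   fun i => if pickle i == k then bn.2 else p.2 i).

Lemma refines_update (K : countType) k (p : (nat -> bool) * (K -> nat)) bn :
  refines k p (update k p bn).
Proof. by split=> i /=; case: eqP => // ->; rewrite ltnn. Qed.

Lemma piece_split (K : countType) R k (p : (nat -> bool) * (K -> nat)) :
  piece R k p `<=` \bigcup_bn piece R k.+1 (update k p bn).
Proof.
move=> x [ax [w [aw r]]].
exists (x k, oapp w 0 (@pickle_inv K k)) => //; split=> /=.
  by move=> i; rewrite ltnS leq_eqVlt; case: eqP => [->//|_ /ax].
exists w; split=> // i; rewrite ltnS leq_eqVlt /=; case: eqP => [<- _|_ /aw//].
by rewrite pickleK_inv.
Qed.

(** Every finite part of the limit of the [st k] is realised by a member of [R], and [R] is
    closed. *)
Lemma piece_limit (K : countType) R (st : nat -> (nat -> bool) * (K -> nat)) :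
  closedR R -> (forall k, refines k (st k) (st k.+1)) ->
  (forall k, piece R k (st k) !=set0) ->
  exists x w, R x w /\ forall k, agree k (st k).1 x /\ prefix_agree k (st k).2 w.
Proof.
move=> cR rst nst.
pose x i := (st i.+1).1 i; pose w i := (st (pickle i).+1).2 i.
have mono k n : refines k (st k) (st (k + n)).
  elim: n => [|n [a b]]; first by rewrite addn0.
  have [a' b'] := rst (k + n); rewrite addnS; split=> i ik.
    by rewrite a' ?a // (leq_trans ik) ?leq_addr.
  by rewrite b' ?b // (leq_trans ik) ?leq_addr.
have ax k : agree k (st k).1 x.
  by move=> i ik; rewrite -[k](subnKC ik); have [-> //] := mono i.+1 (k - i.+1).
have aw k : prefix_agree k (st k).2 w.
  by move=> i ik; rewrite -[k](subnKC ik); have [_ ->] := mono (pickle i).+1 (k - (pickle i).+1).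
exists x, w; split=> [|k]; last by split.
apply: cR => N L.
have [k Nk Lk] : exists2 k, N <= k & {in L, forall i, pickle i < k}.
  exists (maxn N (\max_(i <- L) (pickle i).+1)); first exact: leq_maxl.
  by move=> i iL; rewrite leq_max; apply/orP; right;
    exact: (@leq_bigmax_seq _ L xpredT (fun i => (pickle i).+1)).
have [x' [ax' [w' [aw' r]]]] := nst k; exists x', w'; split=> //.
  by apply: (agree_le Nk); apply: agree_trans ax' (ax k).
by move=> i /Lk ik; rewrite aw' ?aw.
Qed.

(** Lusin's separation theorem. If the sets are inseparable, so is some pair of their pieces at
    every depth, each pair refining the previous one. The limits [x] in [A] and [y] in [A'] differ
    at some [i], and the clopen set of the [z] with [z i = x i] separates the pieces of depth
    [i + 1]. *)
Lemma analytic_separation A A' :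
  analytic A -> analytic A' -> (forall x, A x -> ~ A' x) -> codable_sep A A'.
Proof.
move=> [K [R [cR AR]]] [K' [R' [cR' AR']]] disj; apply: contrapT => nsep.
pose S := (((nat -> bool) * (K -> nat)) * ((nat -> bool) * (K' -> nat)))%type.
pose Q k (s : S) := ~ codable_sep (piece R k s.1) (piece R' k s.2).
pose T k (s s' : S) := refines k s.1 s'.1 /\ refines k s.2 s'.2.
have sub B B' C C' : B `<=` C -> B' `<=` C' -> codable_sep C C' -> codable_sep B B'.
  move=> BC BC' [D [cD CD CD']]; exists D; split=> //.
    exact: subset_trans CD.
  exact: subset_trans CD'.
pose s0 : S := ((fun=> false, fun=> 0), (fun=> false, fun=> 0)).
have Q0 : Q 0 s0.
  move=> sep; apply: nsep; apply: sub sep.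
    by move=> x /AR[w r]; split=> //; exists w.
  by move=> x /AR'[w r]; split=> //; exists w.
have step k s : Q k s -> exists s', Q k.+1 s' /\ T k s s'.
  move=> nQ; apply: contrapT => h; apply: nQ.
  apply: sub (@piece_split _ _ _ _) (@piece_split _ _ _ _) _.
  apply: codable_sep_bigcup => bn; apply: codable_sepC.
  apply: codable_sep_bigcup => bn'; apply: codable_sepC.
  apply: contrapT => n; apply: h; exists (update k s.1 bn, update k s.2 bn').
  by split=> //; split; apply: refines_update.
have [st [_ stP]] := dependent_choice_nat Q0 step.
have ne0 k : piece R k (st k).1 !=set0.
  apply/set0P/eqP => e; have [] := stP k; rewrite /Q e => + _; apply.
  by exists set0; split=> [|//|x _ []]; apply: (@codable_clopen 0).
have ne1 k : piece R' k (st k).2 !=set0.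
  apply/set0P/eqP => e; have [] := stP k; rewrite /Q e => + _; apply.
  by exists setT; split=> [|//|//]; apply: (@codable_clopen 0).
have [|x [w [r ax]]] := piece_limit cR _ ne0; first by move=> k; have [_ []] := stP k.
have [|y [w' [r' ay]]] := piece_limit cR' _ ne1; first by move=> k; have [_ []] := stP k.
have xy : x <> y.
  by move=> e; apply: (disj x); [apply/AR; exists w|rewrite e; apply/AR'; exists w'].
have [i nxy] : exists i, x i <> y i.
  by apply: contrapT => h; apply: xy; apply/funext => i; apply: contrapT => n; apply: h; exists i.
have [+ _] := stP i.+1; apply; exists [set z | z i = x i]; split.
- by apply: (@codable_clopen i.+1) => z z' az <-; apply/esym/az.
- by move=> z [az _] /=; rewrite az // (ax i.+1).1.
- by move=> z [az _] /=; rewrite az // (ay i.+1).1 // => e; apply: nxy.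
Qed.

(** * Independent sets *)

Definition independent (B : set (nat -> bool)) : Prop :=
  forall n x y, edge n x y -> B x -> B y -> False.

Definition in_sword n : set (nat -> bool) := [set x | agree n x (nth false (sword n))].

Lemma in_sword_flip n x : in_sword n (flip n x) <-> in_sword n x.
Proof.
split=> h; apply: agree_trans h; last exact: flip_agree.
exact/agree_sym/flip_agree.
Qed.

Lemma codable_in_sword n : codable (in_sword n).
Proof. by apply: (@codable_clopen n) => x y /agree_sym; apply: agree_trans. Qed.

Lemma edge_in_sword n x : in_sword n x -> edge n x (flip n x) \/ edge n (flip n x) x.
Proof.
move=> sx; case e: (x n); [right|left]; split=> //.
- exact/in_sword_flip.
- by rewrite /flip eqxx e.
- by rewrite flipK.
Qed.

(* Separating [A] from each of its shifts [A n] gives a Borel [C] which contains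
   [A]; removing the shifts of [C] from [C] makes it independent. *)
Lemma analytic_independent A : analytic A -> independent A ->
  exists B, [/\ codable B, independent B & A `<=` B].
Proof.
move=> aA iA.
pose shift (C : set (nat -> bool)) n := in_sword n `&` flip n @^-1` C.
have /choice[C hC] n : exists C, [/\ codable C, A `<=` C & shift A n `<=` ~` C].
  apply: analytic_separation => // [|x Ax [sx Afx]].
    have := analytic_setD (analytic_preim (lipschitz_flip n) aA) (codableC (codable_in_sword n)).
    by rewrite setDE setCK setIC.
  by have [/iA|/iA] := edge_in_sword sx; apply.
pose D := \bigcap_n C n.
exists (D `\` \bigcup_n shift D n); split.
- have cD : codable D by apply: codable_bigcap => n; have [] := hC n.
  apply: codable_setI => //; apply/codableC/codable_bigcup => n.
  by apply: codable_setI; [exact: codable_in_sword|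
    apply: codable_preim => //; exact: lipschitz_flip].
- by move=> n x y [sx _ ->] [_ nx] [Dy _]; apply: nx; exists n.
- move=> x Ax; split=> [n _|[n _ [sx Dfx]]]; first by have [_ sC _] := hC n; apply: sC.
  (* The point [flip n x] lies in [shift A n], hence outside [C n], although it is in [D]. *)
  have [_ _] := hC n; move/(_ (flip n x)); apply; last exact: Dfx.
  by split; [apply/in_sword_flip|rewrite /preimage /= flipK].
Qed.

(** * The dichotomy *)

Definition flips (ms : seq nat) (s : seq bool) (y : nat -> bool) : nat -> bool :=
  fun i => ((i \in ms) && nth false s (index i ms)) (+) y i.

Lemma flipsK ms s : involutive (flips ms s).
Proof. by move=> y; apply/funext => i; rewrite /flips addbA addbb. Qed.

Lemma agree_flips ms s N x y : agree N x y -> agree N (flips ms s x) (flips ms s y).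
Proof. by move=> h i iN; rewrite /flips h. Qed.

Lemma lipschitz_flips ms s : cantor_lipschitz (flips ms s).
Proof. by exists 0 => N x y; rewrite addn0; apply: agree_flips. Qed.

Lemma flips_flip ms s n y : flips ms s (flip n y) = flip n (flips ms s y).
Proof. by apply/funext => i; rewrite /flips /flip !addbA; congr (_ (+) _); rewrite addbC. Qed.

Lemma flips_rcons ms s m b y : size s = size ms -> m \notin ms ->
  flips (rcons ms m) (rcons s b) y = flips ms s (if b then flip m y else y).
Proof.
move=> sms mms; apply/funext => i; rewrite /flips mem_rcons inE.
rewrite -!cats1 index_cat nth_cat.
have [->|im] := eqVneq i m.
  rewrite (negbTE mms) /= eqxx addn0 sms ltnn subnn /=.
  by case: b; rewrite // /flip eqxx.
rewrite /=; case: (boolP (i \in ms)) => [ims|_] /=.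
  by rewrite sms index_mem ims; case: b; rewrite // /flip (negbTE im).
by case: b; rewrite // /flip (negbTE im).
Qed.

Lemma flips_notin ms s y i : i \notin ms -> flips ms s y i = y i.
Proof. by rewrite /flips => /negbTE ->. Qed.

Lemma flips_mkseq (m : nat -> nat) (al y : nat -> bool) n k : injective m -> k < n ->
  flips (mkseq m n) (mkseq al n) y (m k) = al k (+) y (m k).
Proof.
move=> mi kn; rewrite /flips.
have kin : k \in iota 0 n by rewrite mem_iota.
have ik : index k (iota 0 n) = k.
  by rewrite -[X in index X](nth_iota 0 0 kn) index_uniq ?iota_uniq ?size_iota.
by rewrite /mkseq map_f // index_map // ik (nth_map 0) ?size_iota // nth_iota.
Qed.

(** The sigma-ideal driving the dichotomy: each base point in [E] has one of its [flips] copies in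
    one of countably many Borel independent sets. For [ms = [::]] this is a countable cover by Borel
    independent sets. *)
Definition small ms (E : set (nat -> bool)) : Prop :=
  exists (I : countType) (c : I -> seq bool * set (nat -> bool)),
    (forall i, [/\ size (c i).1 = size ms, codable (c i).2 & independent (c i).2]) /\
    forall y, E y -> exists i, (c i).2 (flips ms (c i).1 y).

Lemma small_set0 ms : small ms set0.
Proof. by exists void, (fun=> ([::], set0)); split=> [[]|y []]. Qed.

Lemma small_subset ms E E' : E `<=` E' -> small ms E' -> small ms E.
Proof. by move=> EE' [I [c [cP h]]]; exists I, c; split=> // y /EE'/h. Qed.

Lemma small_bigcup ms (J : countType) (E : J -> set (nat -> bool)) :
  (forall j, small ms (E j)) -> small ms (\bigcup_j E j).
Proof.
move=> /choice[I /(fun h j => cid (h j)) c].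
exists {j : J & I j}, (fun p => projT1 (c (tag p)) (tagged p)).
split=> [[j i]|y [j _ Ey]]; first by have [] := projT2 (c j).
by have [_ /(_ _ Ey)[i Bi]] := projT2 (c j); exists (Tagged I i).
Qed.

(* An approximate copy of the finite graph induced by [G0] on the words of length
   [n = size ms]: the word [s] is sent to [flips ms s y], the edges added at step [k]
   become flips of the bit [nth 0 ms k], and [w s] witnesses that the image of [s]
   lies in the projection of [Gam]. *)
Definition config (Gam : (nat -> bool) -> (nat -> nat) -> Prop) ms N v
    (u : seq bool -> nat -> nat) (y : nat -> bool) (w : seq bool -> nat -> nat) : Prop :=
  agree N y v /\
  forall s, size s = size ms -> agree N (w s) (u s) /\ Gam (flips ms s y) (w s).

Definition base Gam ms N v u : set (nat -> bool) :=
  [set y | exists w, config Gam ms N v u y w].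

Lemma analytic_base Gam ms N v u : closedR Gam -> analytic (base Gam ms N v u).
Proof.
move=> cG; exists (seq bool * nat)%type,
  (fun y b => config Gam ms N v u y (fun s i => b (s, i))); split; last first.
  move=> y; split=> [[w h]|[b h]]; last by eexists; exact: h.
  by exists (fun p => w p.1 p.2).
move=> y b h; split.
  by have [y' [w' [ay _ [yv _]]]] := h N [::]; apply: agree_trans yv; apply: agree_sym.
move=> s ss; split.
  have [y' [w' [_ wb [_ /(_ s ss)[wu _]]]]] := h 0 [seq (s, i) | i <- iota 0 N].
  by move=> i iN; rewrite -wu // wb // map_f // mem_iota.
apply: cG => N' L; have [y' [w' [ay wb [_ /(_ s ss)[_ g]]]]] := h N' (map (pair s) L).
exists (flips ms s y'), (fun i => w' (s, i)); split=> //; first exact: agree_flips.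
by move=> i iL; rewrite wb // map_f.
Qed.

(** * The fusion construction *)

Record stage := Stage {
  st_ms : seq nat; st_N : nat; st_v : nat -> bool; st_u : seq bool -> nat -> nat }.

(** The last clause keeps the current approximation exactly in [Gam], so that the limit lies in
    [Gam] by closedness. *)
Definition good_stage Gam (s : stage) : Prop :=
  [/\ {in st_ms s, forall m, m < st_N s},
      ~ small (st_ms s) (base Gam (st_ms s) (st_N s) (st_v s) (st_u s)) &
      forall r, size r = size (st_ms s) ->
        Gam (flips (st_ms s) r (st_v s)) (st_u s r)].

Definition next_stage (n : nat) (s s' : stage) : Prop :=
  exists m, [/\ st_ms s' = rcons (st_ms s) m, st_N s <= m /\ st_N s' = m.+1,
    agree (st_N s) (st_v s') (st_v s),
    st_v s' m = false /\ in_sword m (flips (st_ms s) (sword n) (st_v s')) &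
    forall r b, size r = size (st_ms s) ->
      agree (st_N s) (st_u s' (rcons r b)) (st_u s r)].

(** The base points from which one more step can be made: copies of words ending in 0 come from [y],
    copies of words ending in 1 from [flip m y], and the copies of the two extensions of
    [sword (size ms)] are to be joined by an edge. *)
Definition extension Gam ms N v u m : set (nat -> bool) :=
  [set y | exists w, [/\ N <= m, y m = false,
     in_sword m (flips ms (sword (size ms)) y),
     config Gam ms N v u y (fun s => w (rcons s false)) &
     config Gam ms N v u (flip m y) (fun s => w (rcons s true))]].

(* If all extensions were small, removing from the base the pieces covering them
   would leave an analytic set whose [sword]-translate is independent, and the
   base would be small. *)
Lemma extension_large Gam ms N v u : closedR Gam ->
  {in ms, forall m, m < N} ->
  ~ small ms (base Gam ms N v u) ->
  exists m, ~ small (rcons ms m) (extension Gam ms N v u m).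
Proof.
move=> cG msN large; apply: contrapT => h.
have {h} /choice[I /(fun h m => cid (h m)) c] :
    forall m, small (rcons ms m) (extension Gam ms N v u m).
  by move=> m; apply: contrapT => n; apply: h; exists m.
pose t m i := (projT1 (c m) i).1; pose B m i := (projT1 (c m) i).2.
have tB m : (forall i, [/\ size (t m i) = size (rcons ms m), codable (B m i) &
    independent (B m i)]) /\ forall y, extension Gam ms N v u m y ->
    exists i, B m i (flips (rcons ms m) (t m i) y) by exact: projT2 (c m).
pose n := size ms.
pose J : countType := {m : nat & I m}.
(* The last digit of a translating word only selects [y] or [flip m y], and both are base points, so
   it is dropped. *)
pose t' (j : J) := take n (t (tag j) (tagged j)).
pose B' (j : J) := B (tag j) (tagged j).
have t'P j : size (t' j) = n.
  rewrite size_take; have [/(_ (tagged j))[-> _ _] _] := tB (tag j).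
  by rewrite size_rcons ltnSn.
have B'P j : codable (B' j) /\ independent (B' j).
  by have [/(_ (tagged j))[_ ? ?] _] := tB (tag j).
pose Bs := \bigcup_k (if unpickle k is Some j then flips ms (t' j) @^-1` B' j else set0).
have BsE y j : B' j (flips ms (t' j) y) -> Bs y.
  by move=> h; exists (pickle j) => //; rewrite pickleK.
have cBs : codable Bs.
  apply: codable_bigcup => k; case: unpickle => [j|]; last exact: (@codable_clopen 0).
  by apply: codable_preim; [exact: lipschitz_flips|have [] := B'P j].
pose A := flips ms (sword n) @^-1` (base Gam ms N v u `\` Bs).
have aA : analytic A.
  apply: analytic_preim (lipschitz_flips _ _) _.
  by apply: analytic_setD cBs; apply: analytic_base.
have [iA|] := pselect (independent A).
  have [B0 [cB0 iB0 AB0]] := analytic_independent aA iA; apply: large.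
  exists (option J), (fun o => if o is Some j then (t' j, B' j) else (sword n, B0)); split.
    by case=> [j|] /=; [have [] := B'P j; split; rewrite ?t'P|split=> //; rewrite size_sword].
  move=> y by_; have [[k _]|nBs] := pselect (Bs y).
    by case: unpickle => // j Bj; exists (Some j).
  by exists None; apply: AB0; rewrite /A /preimage /= flipsK.
(* An edge inside [A] gives base points [y1] and [flip m y1] outside [Bs]. But [y1] is in the
   extension for [m], whose cover puts one of the two into [Bs]. *)
apply=> m x y [sx xm ->] [[w1 h1] nB1] [[w2 h2] nB2].
set y1 := flips ms (sword n) x in h1 nB1; rewrite flips_flip -/y1 in h2 nB2.
have Nm : N <= m.
  rewrite leqNgt; apply/negP => mN; have [a1 _] := h1; have [a2 _] := h2.
  by have := a2 m mN; rewrite -(a1 m mN) /flip eqxx; case: (y1 m).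
have mms : m \notin ms by apply/negP => /msN; rewrite ltnNge Nm.
have [ti /(_ y1)[]] := tB m.
  exists (fun s => if last false s then w2 (take n s) else w1 (take n s)).
  have tk s b : size s = n -> take n (rcons s b) = s.
    by move=> <-; rewrite -cats1 take_size_cat.
  split=> //.
  - by rewrite /y1 flips_notin.
  - by rewrite /y1 flipsK.
  - by have [a1 b1] := h1; split=> // s ss; rewrite last_rcons tk //; apply: b1.
  - by have [a2 b2] := h2; split=> // s ss; rewrite last_rcons tk //; apply: b2.
move=> i; have [] := ti i; have := @BsE _ (Tagged I i : J); rewrite /t' /B' /=.
case/lastP: (t m i) => [|s b]; rewrite !size_rcons // => BsE' [ss] _ _.
rewrite -cats1 take_size_cat // in BsE'.
by rewrite flips_rcons //; case: b BsE' => BsE' /BsE'.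
Qed.

(** The first [m + 1] digits of the base point and of its witnesses split a large extension into
    countably many classes. One class is large, and any of its members provides the new
    approximation. *)
Lemma stage_step Gam n s : closedR Gam -> good_stage Gam s -> size (st_ms s) = n ->
  exists s', good_stage Gam s' /\ next_stage n s s'.
Proof.
case: s => ms N v u cG [/= msN large _] sn.
have [m] := extension_large cG msN large.
pose code (y : nat -> bool) (w : seq bool -> nat -> nat) :=
  (mkseq y m.+1, [seq mkseq (w r) m.+1 | r <- words n.+1]).
pose E (c : seq bool * seq (seq nat)) := [set y | exists w,
   [/\ N <= m, y m = false, in_sword m (flips ms (sword n) y),
     config Gam ms N v u y (fun s => w (rcons s false)) &
     config Gam ms N v u (flip m y) (fun s => w (rcons s true))] /\ code y w = c].
move=> largeE; have [c largec] : exists c, ~ small (rcons ms m) (E c).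
  apply: contrapT => h; apply: largeE; apply: (@small_subset _ _ (\bigcup_c E c)).
    by move=> y [w hw]; exists (code y w) => //; exists w; rewrite -sn.
  by apply: small_bigcup => c; apply: contrapT => nc; apply: h; exists c.
have [v' [u' [[Nm vm sv hv0 hv1] cv]]] : E c !=set0.
  by apply/set0P/eqP => e; apply: largec; rewrite e; apply: small_set0.
have mms : m \notin ms by apply/negP => /msN; rewrite ltnNge Nm.
have mk (T : Type) (f g : nat -> T) : mkseq f m.+1 = mkseq g m.+1 -> agree m.+1 f g.
  by move=> e i im; rewrite -(nth_mkseq (f 0) f im) e nth_mkseq.
have conf y w r : config Gam ms N v u y (fun s => w (rcons s false)) ->
     config Gam ms N v u (flip m y) (fun s => w (rcons s true)) ->
     size r = n.+1 -> Gam (flips (rcons ms m) r y) (w r).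
  case/lastP: r => // r b [_ h0] [_ h1]; rewrite size_rcons => -[sr].
  rewrite flips_rcons ?sn //; case: b; first by have [] := h1 r; rewrite ?sn.
  by have [] := h0 r; rewrite ?sn.
exists (Stage (rcons ms m) m.+1 v' u'); split.
  split=> /=.
  - move=> i; rewrite mem_rcons inE => /orP[/eqP->//|/msN iN].
    exact: leq_trans iN (leqW Nm).
  - apply: contra_not largec; apply: small_subset => y [w [[_ _ _ hy0 hy1]]].
    rewrite -cv => e; exists w; split; first exact: mk (congr1 fst e).
    move=> r; rewrite size_rcons sn => sr; split; last exact: conf.
    apply: mk; have rw : r \in words n.+1 by rewrite size_mem_words sr.
    by move/(congr1 snd)/eq_in_map: e; apply.
  - by move=> r; rewrite size_rcons sn => sr; apply: conf.
exists m; split=> //=.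
- by case: hv0.
- by move=> r [] sr; [case: hv1|case: hv0] => _ /(_ r sr)[].
Qed.

(** The fusion limit: [a al] is the limit base point [y0] with bit [m k] flipped wherever [al k]
    holds, and [W al] is the limit of the witnesses. Edges are preserved by the choice of [m] at
    each step, and reflected because images can differ only at the positions [m k]. *)
Lemma G0_embedding Gam : closedR Gam -> ~ small [::] [set y | exists w, Gam y w] ->
  exists (a : (nat -> bool) -> nat -> bool) (W : (nat -> bool) -> nat -> nat),
    [/\ forall al, Gam (a al) (W al),
        forall al be i, agree i.+1 al be -> W al i = W be i,
        injective a &
        forall al be, (exists n, edge n al be) <-> exists n, edge n (a al) (a be)].
Proof.
move=> cG large.
have [v0 [w0 g0]] : [set y | exists w, Gam y w] !=set0.
  by apply/set0P/eqP => e; apply: large; rewrite e; apply: small_set0.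
pose Q n s := good_stage Gam s /\ size (st_ms s) = n.
have Q0 : Q 0 (Stage [::] 0 v0 (fun=> w0)).
  split=> //; split=> //=.
  apply: contra_not large; apply: small_subset => y [w g].
  by exists (fun=> w); split=> // s /size0nil ->.
have step n s : Q n s -> exists s', Q n.+1 s' /\ next_stage n s s'.
  move=> [gs sn]; have [s' [gs' ns']] := stage_step cG gs sn.
  exists s'; split=> //; split=> //.
  by have [m [-> _ _ _ _]] := ns'; rewrite size_rcons sn.
have [st [st0 stP]] := dependent_choice_nat Q0 step.
pose ms n := st_ms (st n); pose N n := st_N (st n).
pose v n := st_v (st n); pose u n := st_u (st n).
have sms n : size (ms n) = n by have [[]] := stP n.
have good n : good_stage Gam (st n) by have [[]] := stP n.
have /choice[m mP] n := (stP n).2.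
have msE n : ms n = mkseq m n.
  elim: n => [|n IH]; first by rewrite /ms st0.
  by have [e _ _ _ _] := mP n; rewrite /ms e -/(ms n) IH mkseqS.
have NS n : N n.+1 = (m n).+1 by have [_ [_ e] _ _ _] := mP n.
have Nm n : N n <= m n by have [_ [e _] _ _ _] := mP n.
have mS n : m n < m n.+1 by rewrite -NS Nm.
have m_lt : {homo m : i j / i < j} := homo_ltn ltn_trans mS.
have m_mono : {mono m : i j / i < j} := leqW_mono (leq_mono m_lt).
have mi : injective m := incn_inj (leq_mono m_lt).
have nN n : n <= N n.
  case: n => // n; rewrite NS ltnS.
  by elim: n => // n IH; apply: leq_ltn_trans IH (mS n).
have N_le n p : N n <= N (n + p).
  elim: p => [|p IH]; first by rewrite addn0.
  by rewrite addnS NS (leq_trans IH) // ltnW // ltnS Nm.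
have vv n p : agree (N n) (v (n + p)) (v n).
  elim: p => [|p IH]; first by rewrite addn0.
  rewrite addnS; apply: agree_trans IH; apply: (agree_le (N_le n p)).
  by have [_ _ av _ _] := mP (n + p).
have uu (al : nat -> bool) n p :
    agree (N n) (u (n + p) (mkseq al (n + p))) (u n (mkseq al n)).
  elim: p => [|p IH]; first by rewrite addn0.
  rewrite addnS mkseqS; apply: agree_trans IH; apply: (agree_le (N_le n p)).
  have [_ _ _ _ au] := mP (n + p); apply: au.
  by rewrite -/(ms (n + p)) sms size_mkseq.
pose y0 i := v i.+1 i.
have y0v n : agree (N n) y0 (v n) by exact: (@agree_diagonal _ N v nN vv).
pose W al i := u i.+1 (mkseq al i.+1) i.
have Wu (al : nat -> bool) n : agree (N n) (W al) (u n (mkseq al n)).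
  exact: (@agree_diagonal _ N (fun n => u n (mkseq al n)) nN (uu al)).
(* A flip at position [i = m k] has [k <= i], so [i + 1] flips decide the value at [i]. *)
pose a (al : nat -> bool) i := flips (mkseq m i.+1) (mkseq al i.+1) y0 i.
have notin i n : (forall k, m k <> i) -> i \notin mkseq m n.
  by move=> h; apply/negP => /mapP[k _ e]; apply: (h k).
have am al k : a al (m k) = al k (+) y0 (m k).
  by apply: flips_mkseq => //; rewrite ltnS; apply: leq_trans (nN k) (Nm k).
have an al i : (forall k, m k <> i) -> a al i = y0 i.
  by move=> h; apply: flips_notin; apply: notin.
have y0m k : y0 (m k) = false.
  by have [_ _ _ [vm _] _] := mP k; rewrite -vm (y0v k.+1) // NS.
(* Below [m n] only the first [n] flips can act. The depth [p] is kept apart from [n] because all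
   digits below [m n] are sure to be frozen only at stage [n + 1]. *)
have afl (al : nat -> bool) n p : agree (N p) (v p) y0 ->
    forall i, i < m n -> i < N p -> a al i = flips (ms n) (mkseq al n) (v p) i.
  move=> ay i im iN; rewrite msE.
  have [[k mk]|nk] := pselect (exists k, m k = i).
    rewrite -mk in im iN *; rewrite am flips_mkseq ?ay //; by rewrite -m_mono.
  rewrite an; last by move=> k mk; apply: nk; exists k.
  by rewrite flips_notin ?ay //; apply: notin => k mk; apply: nk; exists k.
have asw al n : agree n al (nth false (sword n)) -> in_sword (m n) (a al).
  move=> aal i im; have [_ _ _ [_ sw] _] := mP n.
  rewrite (afl _ n n.+1 (agree_sym (y0v _)) i im); last by rewrite NS ltnS ltnW.
  rewrite -sw //; congr flips; apply: (@eq_from_nth _ false).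
    by rewrite size_mkseq size_sword.
  by move=> k; rewrite size_mkseq => kn; rewrite nth_mkseq // aal.
have ainj : injective a.
  move=> al be e; apply/funext => k.
  by have := am al k; rewrite e am => /addIb.
exists a, W; split=> //.
- move=> al; apply: cG => K L.
  have [n Kn Ln] : exists2 n, K <= n & {in L, forall i, i < n}.
    exists (maxn K (\max_(i <- L) i.+1)); first exact: leq_maxl.
    by move=> i iL; rewrite leq_max; apply/orP; right; exact: (@leq_bigmax_seq _ L xpredT).
  exists (flips (ms n) (mkseq al n) (v n)), (u n (mkseq al n)); split.
  + move=> i iK; have iN : i < N n by apply: leq_trans iK (leq_trans Kn (nN n)).
    by rewrite -afl //; [exact/agree_sym|apply: leq_trans iN (Nm n)].
  + by move=> i /Ln ii; rewrite (Wu al n) //; apply: leq_trans ii (nN n).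
  + by have [_ _] := good n; apply; rewrite -/(ms n) sms size_mkseq.
- move=> al be i ab; rewrite /W (_ : mkseq al i.+1 = mkseq be i.+1) //.
  apply: (@eq_from_nth _ false); rewrite ?size_mkseq // => k kn.
  by rewrite !nth_mkseq // ab.
move=> al be; split=> [[n [aal aln ->]]|[j [sj aj e]]].
  exists (m n); split; first exact: asw.
    by rewrite am aln y0m.
  apply/funext => i; rewrite /flip.
  have [[k <-]|nk] := pselect (exists k, m k = i).
    by rewrite !am (inj_eq mi) addbA.
  have nk' k : m k <> i by move=> mk; apply: nk; exists k.
  by rewrite !an //; case: eqP => // e; case: (nk' n).
have [k mk] : exists k, m k = j.
  apply: contrapT => nk; have nk' k : m k <> j by move=> mk; apply: nk; exists k.
  have := congr1 (@^~ j) e; rewrite /flip eqxx an // an //.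
  by case: (y0 j).
rewrite -mk in sj aj e; exists k; split.
(* Both [a al] and the image of [sword k] agree with [sword (m k)] below [m k]; comparing them at
   [m i] cancels [y0 (m i)] and gives the digit [al i]. *)
- move=> i ik; have := sj (m i); rewrite m_mono ik => /(_ isT) sji.
  have := @asw (nth false (sword k)) k (fun _ _ => erefl) (m i).
  by rewrite m_mono ik => /(_ isT); rewrite -sji !am => /addIb.
- by have := aj; rewrite am y0m addbF.
- apply/funext => i; have := congr1 (@^~ (m i)) e.
  by rewrite /flip !am (inj_eq mi) addbA => /addIb.
Qed.

(** * Baire category *)

Definition nowhere_dense (E : set (nat -> bool)) : Prop :=
  forall x k, exists y n, [/\ k <= n, agree k y x & forall z, agree n z y -> ~ E z].

Definition meager (M : set (nat -> bool)) : Prop :=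
  exists (I : countType) (E : I -> set (nat -> bool)),
    (forall i, nowhere_dense (E i)) /\ M `<=` \bigcup_i E i.

Lemma meager_nowhere_dense E : nowhere_dense E -> meager E.
Proof. by move=> nE; exists unit, (fun=> E); split=> // x Ex; exists tt. Qed.

Lemma meager_subset M M' : M `<=` M' -> meager M' -> meager M.
Proof. by move=> MM' [I [E [nE ME]]]; exists I, E; split=> // x /MM'/ME. Qed.

Lemma meager_bigcup (J : countType) (M : J -> set (nat -> bool)) :
  (forall j, meager (M j)) -> meager (\bigcup_j M j).
Proof.
move=> /choice[I /(fun h j => cid (h j)) E].
exists {j : J & I j}, (fun p => projT1 (E (tag p)) (tagged p)); split=> [[j i]|x [j _ Mx]].
  by have [] := projT2 (E j).
by have [_ /(_ _ Mx)[i _ Ei]] := projT2 (E j); exists (Tagged I i).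
Qed.

Lemma meager_setU M M' : meager M -> meager M' -> meager (M `|` M').
Proof.
move=> mM mM'; apply: (@meager_subset _ (\bigcup_(b : bool) (if b then M else M'))).
  by move=> x [Mx|Mx]; [exists true|exists false].
by apply: meager_bigcup => -[].
Qed.

(** The Baire category theorem: a cylinder is shrunk past the nowhere dense sets one by one, its
    length growing strictly so that a limit point is determined. *)
Lemma baire M x k : meager M -> exists y, agree k y x /\ ~ M y.
Proof.
move=> [I [E [nE ME]]].
pose Q (_ : nat) (s : (nat -> bool) * nat) := True.
pose T p (s s' : (nat -> bool) * nat) := [/\ s.2 < s'.2, agree s.2 s'.1 s.1 &
  forall i : I, unpickle p = Some i -> forall z, agree s'.2 z s'.1 -> ~ E i z].
have step p s : Q p s -> exists s', Q p.+1 s' /\ T p s s'.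
  case: s => y n _; case e: (unpickle p : option I) => [i|]; last first.
    by exists (y, n.+1); split=> //; split=> //= i; rewrite e.
  have [y' [n' [nn' ay hE]]] := nE i y n.+1.
  exists (y', n'); split=> //; split=> //=; first exact: agree_le ay.
  by move=> j; rewrite e => -[<-].
have [st [st0 stP]] := @dependent_choice_nat _ Q T (x, k) Logic.I step.
pose N p := (st p).2; pose v p := (st p).1.
have N_le p r : N p <= N (p + r).
  elim: r => [|r IH]; first by rewrite addn0.
  by rewrite addnS (leq_trans IH) //; have [_ [/ltnW]] := stP (p + r).
have vv p r : agree (N p) (v (p + r)) (v p).
  elim: r => [|r IH]; first by rewrite addn0.
  rewrite addnS; apply: agree_trans IH; apply: (agree_le (N_le p r)).
  by have [_ []] := stP (p + r).
have pN p : p <= N p.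
  by elim: p => // p IH; apply: leq_ltn_trans IH _; have [_ []] := stP p.
have yv := @agree_diagonal _ N v pN vv.
exists (fun i => v i.+1 i); split; first by have := yv 0; rewrite /N /v st0.
move=> /ME[i _]; have [_ [_ _]] := stP (pickle i); apply; first by rewrite pickleK.
exact: yv.
Qed.

Lemma agree_maxn T m n (x y : nat -> T) :
  agree (maxn m n) x y -> agree m x y /\ agree n x y.
Proof. by move=> a; split; apply: agree_le a; rewrite ?leq_maxl ?leq_maxr. Qed.

(* [interior_meager A] is the largest open set in which [A] is meager; its
   complement plays the role of a closed hull of [A] modulo meager sets. *)
Definition interior_meager (A : set (nat -> bool)) : set (nat -> bool) :=
  [set x | exists n, meager (A `&` [set z | agree n z x])].

Lemma interior_meager_open A x : interior_meager A x ->
  exists n, forall y, agree n y x -> interior_meager A y.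
Proof.
move=> [n mA]; exists n => y ayx; exists n.
by apply: meager_subset mA => z [Az azy]; split=> //; apply: agree_trans ayx.
Qed.

(** There are only countably many cylinders, and those in which [A] is meager cover
    [interior_meager A]. *)
Lemma meager_interior_meager A : meager (A `&` interior_meager A).
Proof.
pose cyl (u : seq bool) := [set z : nat -> bool | agree (size u) z (nth false u)].
apply: (@meager_subset _ (\bigcup_(u : seq bool)
    [set z | A z /\ cyl u z /\ meager (A `&` cyl u)])).
  have cylE (x : nat -> bool) n : cyl (mkseq x n) = [set z | agree n z x].
    by apply/seteqP; split=> z h i; rewrite ?size_mkseq => il;
      [rewrite h ?size_mkseq|rewrite h]; rewrite ?nth_mkseq.
  by move=> x [Ax [n mA]]; exists (mkseq x n); rewrite // cylE; split.
apply: meager_bigcup => u; have [m|nm] := pselect (meager (A `&` cyl u)).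
  by apply: meager_subset m => z [Az [cz _]].
by apply: meager_nowhere_dense => x k; exists x, k; split=> // z _ [_ [_]].
Qed.

Lemma meager_hull_boundary A : meager [set x | ~ interior_meager A x /\
  forall n, exists z, agree n z x /\ interior_meager A z].
Proof.
apply: meager_nowhere_dense => x k.
have [[y [ayx oy]]|h] := pselect (exists y, agree k y x /\ interior_meager A y).
  have [n hn] := interior_meager_open oy.
  by exists y, (maxn k n); split=> [|//|z /agree_maxn[_ /hn oz] []]; first exact: leq_maxl.
exists x, k; split=> // z az [_ /(_ k)[t [atz ot]]].
by apply: h; exists t; split=> //; apply: agree_trans az.
Qed.

(** If no smaller cylinder inside a given one avoids the set, each [interior_meager (B i)] is open
    and dense there. Then [A] is meager in that cylinder, which therefore lies in
    [interior_meager A], a contradiction. *)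
Lemma meager_hull_bigcup (I : countType) (B : I -> set (nat -> bool)) A :
  A `<=` \bigcup_i B i ->
  meager [set x | ~ interior_meager A x /\ forall i, interior_meager (B i) x].
Proof.
move=> AB; apply: meager_nowhere_dense => x k; apply: contrapT => h.
have dense i y n : agree k y x -> exists z, agree n z y /\ interior_meager (B i) z.
  move=> ayx; apply: contrapT => nz; apply: h.
  exists y, (maxn k n); split=> [|//|z /agree_maxn[_ az] [_ /(_ i) oz]].
    exact: leq_maxl.
  by apply: nz; exists z.
have ox y : agree k y x -> ~ interior_meager A y.
  move=> ayx oy; apply: h; have [n hn] := interior_meager_open oy.
  by exists y, (maxn k n); split=> [|//|z /agree_maxn[_ /hn oz] []]; first exact: leq_maxl.
apply: (ox x) => //; exists k.
apply: (@meager_subset _ (\bigcup_i ((B i `&` interior_meager (B i)) `|`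
    [set z | agree k z x /\ ~ interior_meager (B i) z]))).
  move=> z [/AB[i _ Bz] az]; exists i => //.
  by have [io|nio] := pselect (interior_meager (B i) z); [left|right].
apply: meager_bigcup => i; apply: meager_setU (meager_interior_meager _) _.
apply: meager_nowhere_dense => y n.
have [ayx|nayx] := pselect (agree k y x); last first.
  exists y, (maxn k n); split=> [|//|z /agree_maxn[az _] [azx _]]; first exact: leq_maxr.
  by apply: nayx; apply: agree_trans azx; apply: agree_sym.
have [z [azy oz]] := dense i y n ayx.
have [m hm] := interior_meager_open oz.
by exists z, (maxn n m); split=> [|//|t /agree_maxn[_ /hm ot] []]; first exact: leq_maxl.
Qed.

Lemma meager_flip n M : meager M -> meager (flip n @^-1` M).
Proof.
move=> [I [E [nE ME]]]; exists I, (fun i => flip n @^-1` E i); split; last first.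
  by move=> x /ME[i _ Ex]; exists i.
move=> i x k; have [y [m [km ay hy]]] := nE i (flip n x) k.
exists (flip n y), m; split=> //; first by rewrite -[x](flipK n); apply: agree_flip.
by move=> z az; apply: hy; rewrite -[y](flipK n); apply: agree_flip.
Qed.

Lemma prepend1_0 b a : prepend [:: b] a 0 = b. Proof. by []. Qed.

Lemma prepend1_S b a i : prepend [:: b] a i.+1 = a i.
Proof. by rewrite /prepend /= subn1. Qed.

Lemma agree_prepend1 b n x y :
  agree n.+1 (prepend [:: b] x) (prepend [:: b] y) <-> agree n x y.
Proof.
split=> a i; first by move=> ni; have := a i.+1 ni; rewrite !prepend1_S.
by case: i => // i; rewrite !prepend1_S; apply: a.
Qed.

Lemma prepend1_eta (x : nat -> bool) : x = prepend [:: x 0] (fun i => x i.+1).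
Proof. by apply/funext => -[|i]; rewrite ?prepend1_S. Qed.

Lemma meager_prepend1 b M : meager M -> meager [set x | M (prepend [:: b] x)].
Proof.
move=> [I [E [nE ME]]]; exists I, (fun i => [set x | E i (prepend [:: b] x)]).
split; last by move=> x /ME[i _ Ex]; exists i.
move=> i x k; have [y [n [kn ay hy]]] := nE i (prepend [:: b] x) k.+1.
have y0 : y 0 = b by rewrite ay.
have ye := prepend1_eta y; rewrite y0 in ye.
exists (fun i => y i.+1), n.-1; case: n kn hy => // n kn hy; split=> //.
  by apply/(agree_prepend1 b); rewrite -ye.
by move=> z az; apply: hy; rewrite ye; apply/agree_prepend1.
Qed.

(* A closed relation uniformized on a comeager set: off a meager set, membership in
   the projection of the part of [R] extending a finite word is an open condition. *)
Lemma closedR_generic (R : (nat -> bool) -> (nat -> nat) -> Prop) : closedR R ->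
  exists M, meager M /\ forall x w k, ~ M x -> R x w ->
    exists n, forall y, agree n y x -> ~ M y -> exists w', agree k w' w /\ R y w'.
Proof.
move=> cR.
pose Z (u : seq nat) := [set x | exists w, agree (size u) w (nth 0 u) /\ R x w].
have Zsplit u : Z u `<=` \bigcup_i Z (rcons u i).
  move=> x [w [aw r]]; exists (w (size u)) => //; exists w; split=> // i.
  rewrite size_rcons ltnS nth_rcons; case: ltngtP => // [/aw//|->//].
(* Three kinds of exceptional points for each word [u]: members of [Z u] outside its hull, hull
   points of [Z u] in no hull of a one-digit extension, and boundary points of the hull. *)
pose M := \bigcup_u ((Z u `&` interior_meager (Z u)) `|`
  ([set x | ~ interior_meager (Z u) x /\ forall i, interior_meager (Z (rcons u i)) x] `|`
   [set x | ~ interior_meager (Z u) x /\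
      forall n, exists z, agree n z x /\ interior_meager (Z u) z])).
(* Off [M], a hull point of [Z u] belongs to [Z u]: it stays in the hull of one longer word after
   another, and these words converge to a witness since [R] is closed. *)
have hullZ u x : ~ M x -> ~ interior_meager (Z u) x -> Z u x.
  move=> nM nu.
  pose Q k s := size s = size u + k /\ ~ interior_meager (Z s) x.
  pose T (k : nat) (s s' : seq nat) := exists i, s' = rcons s i.
  have step k s : Q k s -> exists s', Q k.+1 s' /\ T k s s'.
    move=> [sk ns]; apply: contrapT => h; apply: nM; exists s => //; right; left.
    split=> // i; apply: contrapT => ni; apply: h; exists (rcons s i).
    by split; [split=> //; rewrite size_rcons sk addnS|exists i].
  have [|st [st0 stP]] := @dependent_choice_nat _ Q T u _ step.
    by split; rewrite ?addn0.
  have sst k : size (st k) = size u + k by have [[]] := stP k.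
  have nst k i : i < size u + k -> nth 0 (st k.+1) i = nth 0 (st k) i.
    by have [_ [j ->]] := stP k; rewrite nth_rcons sst => ->.
  have [|k|y [w [r aw]]] := @piece_limit nat R (fun k => (x, nth 0 (st k))) cR.
  - move=> k; split=> // i ik /=; rewrite nst //.
    by apply: leq_trans ik (leq_addl _ _).
  - apply/set0P/eqP => e; have [[_ n] _] := stP k; apply: n.
    exists k; apply: meager_subset (meager_nowhere_dense _); last first.
      by move=> z n; exists z, n; split; [exact: leqnn|by []|move=> t _; exact].
    move=> z [[w [aw r]] az] /=; have : set0 z; last by [].
    rewrite -e; split=> //; exists w; split=> // i ik; apply: aw.
    by rewrite sst (leq_trans ik) // leq_addl.
  have -> : x = y by apply/funext => i; have [/(_ i (ltnSn i))] := aw i.+1.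
  exists w; split=> // i iu; have [_ <-//] := aw (size u).
  elim: {1}(size u) => [|k IH] /=; first by rewrite st0.
  by rewrite nst ?IH // (leq_trans iu) ?leq_addr.
exists M; split.
  apply: meager_bigcup => u; apply: meager_setU; first exact: meager_interior_meager.
  apply: meager_setU; last exact: meager_hull_boundary.
  exact: meager_hull_bigcup (Zsplit u).
move=> x w k nM r; pose u := mkseq w k.
have Zw y : Z u y -> exists w', agree k w' w /\ R y w'.
  move=> [w' [aw r']]; exists w'; split=> // i ik.
  by rewrite aw ?size_mkseq // nth_mkseq.
have Zux : Z u x.
  by exists w; split=> // i; rewrite size_mkseq => ik; rewrite nth_mkseq.
have nux : ~ interior_meager (Z u) x by move=> o; apply: nM; exists u => //; left.
apply: contrapT => h; apply: nM; exists u => //; right; right; split=> // n.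
apply: contrapT => hn; apply: h; exists n => y ay nMy; apply: Zw; apply: hullZ => // oy.
by apply: hn; exists y.
Qed.

(** * Polish topologies *)

Import Order.TTheory GRing.Theory Num.Theory.
Local Open Scope ring_scope.

(** The pairs of [T0] with first digit 0 already lie in [G_sG0], so only those with first digit 1
    form a separate case. *)
Lemma U0E x y : U0 (x, y) <-> exists a b,
  [/\ x = prepend [:: false] a, y = prepend [:: true] b &
      exists n, edge n a b \/ edge n b a] \/
  [/\ x = prepend [:: true] a, y = prepend [:: false] b & exists n, edge n a b].
Proof.
split=> [[[a [b [ab [-> ->]]]]|[e [a [b [/G0E ab [-> ->]]]]]]|].
- exists a, b; left; split=> //; case: ab => /G0E[n h]; exists n; [by left|by right].
- exists a, b; case: e; [right|left]; split=> //.
  by case: ab => n h; exists n; left.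
move=> [a [b [[-> -> [n h]]|[-> -> h]]]]; [left|right].
  by exists a, b; split=> //; case: h => h; [left|right]; apply/G0E; exists n.
by exists true, a, b; split=> //; apply/G0E.
Qed.

Lemma nbhs_coord (x : cantor_space) i : nbhs x [set y : cantor_space | y i = x i].
Proof.
have := @proj_continuous nat (fun=> bool) i x [set x i].
by apply; apply: discrete_set1.
Qed.

Lemma nbhs_agree (x : cantor_space) n : nbhs x [set y : cantor_space | agree n y x].
Proof.
elim: n => [|n IH]; first by apply: filterS filterT => y _ i.
apply: filterS (filterI IH (nbhs_coord x n)) => y [ay yn] i.
by rewrite ltnS leq_eqVlt => /predU1P[->|/ay].
Qed.

Section PolishCoding.
Variable R : realType.

Definition is_dense_seq (T : Type) (d : T -> T -> R) (q : nat -> T) :=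
  forall x e, 0 < e -> exists i, d x (q i) < e.

Lemma polish_dense_seq (T : topologicalType) : polish R T -> T ->
  exists (d : T -> T -> R) (q : nat -> T),
    [/\ is_metric d, metric_compatible d, metric_complete d & is_dense_seq d q].
Proof.
move=> [[D /countable_injP[f finj] denseD] [d [md cd kd]]] x0.
pose q n := xget x0 [set x | D x /\ f x = n].
exists d, q; split=> // x e e0.
pose B := [set y | d x y < e].
have nB : nbhs x B by apply/(cd x B); exists e.
have [|y [/interior_subset By Dy]] := denseD B^° _ (@open_interior _ _).
  by exists x.
exists (f y); rewrite /q; case: xgetP => [z _ [Dz fz]|/(_ y)[]//].
by rewrite (finj z y) ?inE.
Qed.

(** [w] codes [x] by approximations from a dense sequence. The weak inequality lets limits keep
    their codes. *)
Definition rep (T : Type) (d : T -> T -> R) (q : nat -> T) (x : T) (w : nat -> nat) :=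
  forall j, d x (q (w j)) <= j.+1%:R^-1.

Lemma rep_exists (T : Type) (d : T -> T -> R) (q : nat -> T) x :
  is_dense_seq d q -> exists w, rep d q x w.
Proof.
move=> dq; have /choice[w hw] j : exists i, d x (q i) < j.+1%:R^-1.
  by apply: dq; rewrite invr_gt0 ltr0n.
by exists w => j; apply/ltW.
Qed.

Lemma small_inv (e : R) : 0 < e -> exists j : nat, j.+1%:R^-1 + j.+1%:R^-1 < e.
Proof.
move=> e0; have [|j] := @ltr_add_invr R 0 (e / 2); first by rewrite divr_gt0.
by rewrite add0r ltr_pdivlMr // mulr_natr mulr2n => h; exists j.
Qed.

Lemma rep_dist (T : Type) (d : T -> T -> R) (q : nat -> T) x y (w w' : nat -> nat) j :
  is_metric d ->
  d x (q (w j)) <= j.+1%:R^-1 -> d y (q (w' j)) <= j.+1%:R^-1 -> w j = w' j ->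
  d x y <= j.+1%:R^-1 + j.+1%:R^-1.
Proof.
move=> [_ _ dC dT] rx ry e; apply: le_trans (dT _ (q (w j)) _) _.
by apply: lerD => //; rewrite dC e.
Qed.

(** Points sharing longer and longer parts of one code form a Cauchy sequence. *)
Lemma rep_limit (T : topologicalType) (d : T -> T -> R) (q u : nat -> T) w :
  is_metric d -> metric_compatible d -> metric_complete d ->
  (forall N j, (j < N)%N -> d (u N) (q (w j)) <= j.+1%:R^-1) ->
  exists x, u @ \oo --> x /\ rep d q x w.
Proof.
move=> md cd kd h; have [_ _ dC dT] := md.
have [|x ux] := kd u.
  move=> e e0; have [j je] := small_inv e0; exists j.+1 => m n jm jn.
  exact: le_lt_trans (@rep_dist _ d q _ _ w w _ md (h _ _ jm) (h _ _ jn) erefl) je.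
exists x; split=> // j; rewrite leNgt; apply/negP => lt.
pose e := d x (q (w j)) - j.+1%:R^-1.
have nB : nbhs x [set y | d x y < e] by apply/(cd x); exists e; rewrite // subr_gt0.
have [N _ hN] := ux _ nB.
have := hN (maxn N j.+1) (leq_maxl _ _); rewrite /= /e ltrBrDr => lt1.
have := le_lt_trans (lerD (lexx _) (h _ _ (leq_maxr N j.+1))) lt1.
by rewrite ltNge dT.
Qed.

Lemma finer_nbhs (X : topologicalType) (s : topology_on X) (x : X) (A : set X) :
  finer s -> nbhs x A -> @nbhs (with_topology s) (with_topology s) x A.
Proof.
move=> fs; rewrite nbhsE => -[B [oB Bx] BA].
by rewrite nbhsE; exists B => //; split=> //; apply: fs.
Qed.

(** Points with a common beginning of their codes are close in the refined topology, and [rep] is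
    closed for the usual one. Off the meager set of [closedR_generic], having a code with a given
    beginning holds throughout a usual neighbourhood. *)
Lemma finer_generic (s : topology_on cantor_space) :
  finer s -> polish R (with_topology s) ->
  exists M, meager M /\ forall (x : cantor_space) A, ~ M x ->
    @nbhs (with_topology s) (with_topology s) x A ->
    exists n, forall y : cantor_space, agree n y x -> ~ M y -> A y.
Proof.
move=> fs ps.
have [d [q [md cd kd dq]]] := polish_dense_seq ps ((fun=> false) : cantor_space).
have cR : closedR (rep d q : (nat -> bool) -> (nat -> nat) -> Prop).
  move=> x w h.
  have /choice[u uP] N : exists x', agree N x' x /\
      forall j, (j < N)%N -> d x' (q (w j)) <= j.+1%:R^-1.
    have [x' [w' [ax wl r]]] := h N (iota 0 N); exists x'; split=> // j jN.
    by rewrite -wl ?mem_iota.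
  have [|l [ul rl]] := @rep_limit (with_topology s) d q u w md cd kd.
    by move=> N; have [] := uP N.
  rewrite (_ : x = l) //; apply/funext => i.
  have [N _ hN] := ul _ (finer_nbhs fs (nbhs_coord (l : cantor_space) i)).
  have /= <- := hN (maxn N i.+1) (leq_maxl _ _).
  by have [/(_ i) -> //] := uP (maxn N i.+1); apply: leq_maxr.
have [M [mM hM]] := closedR_generic cR.
exists M; split=> // x A nM /(cd x)[e e0 BA].
have [w r] := rep_exists x dq.
have [j je] := small_inv e0.
have [n hn] := hM x w j.+1 nM r; exists n => y ay nMy; apply: BA.
have [w' [aw r']] := hn y ay nMy.
exact: le_lt_trans (@rep_dist _ d q _ _ w w' _ md (r j) (r' j) (esym (aw j (ltnSn j)))) je.
Qed.

Lemma U0_not_pot_closed : ~ pot_closed R U0.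
Proof.
move=> [s [t [fs ft ps pt clU]]].
have [Ms [mMs hs]] := finer_generic fs ps; have [Mt [mMt ht]] := finer_generic ft pt.
pose M := [set a | Ms (prepend [:: false] a)] `|` [set b | Mt (prepend [:: true] b)].
have mM : meager M by apply: meager_setU; apply: meager_prepend1.
have [a [_ nMa]] := baire (fun=> false) 0 mM.
have : U0 (prepend [:: false] a, prepend [:: true] a).
  apply: (clU (_, _)) => O [[A B] /= [nA nB] AB].
  have [|n hn] := hs _ _ _ nA; first by move=> m; apply: nMa; left.
  have [|m hm] := ht _ _ _ nB; first by move=> m; apply: nMa; right.
  (* [sword p] agrees with [a] far enough for both neighbourhoods. A generic [b] extending [sword p]
     and 0, with [flip p b] generic too, then gives an edge inside them. *)
  have [p [kp ap]] := sword_dense a (maxn n m).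
  have [b [ab nMb]] := baire (fun i => if (i < p)%N then nth false (sword p) i else false) p.+1
    (meager_setU mM (meager_flip p mM)).
  have abp : agree p b (nth false (sword p)) by move=> i ip; rewrite ab ?ip // ltnW.
  have abm : agree (maxn n m) b a.
    move=> i im; rewrite ap // abp //; apply: leq_trans im kp.
  have [abn abm'] := agree_maxn abm.
  exists (prepend [:: false] b, prepend [:: true] (flip p b)); split.
    apply/U0E; exists b, (flip p b); left; split=> //; exists p; left; split=> //.
    by rewrite ab // ltnn.
  apply: AB; split=> /=.
    apply: hn => [|Mb]; last by apply: nMb; left; left.
    by apply: (@agree_le _ _ n.+1) => //; apply/agree_prepend1.
  apply: hm => [|Mb]; last by apply: nMb; right; right.
  apply: (@agree_le _ _ m.+1) => //; apply/agree_prepend1.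
  apply: agree_trans abm'; apply: (@agree_le _ _ p); last exact: flip_agree.
  exact: leq_trans (leq_maxr _ _) kp.
move=> /U0E[x [y [[e1 e2 [n h]]|[e1 _ _]]]].
  have pinj c u v : prepend [:: c] u = prepend [:: c] v -> u = v.
    by move=> e; apply/funext => i; rewrite -(prepend1_S c u) e prepend1_S.
  by move: h; rewrite -(pinj _ _ _ e1) -(pinj _ _ _ e2) => -[] /edge_irrefl.
by have := congr1 (@^~ 0%N) e1.
Qed.

End PolishCoding.

(** * The topology of a metric *)

Section Metrized.
Variables (R : realType) (T : choiceType) (d : T -> T -> R).

Definition metrized (md : is_metric d) : Type := T.

Variable md : is_metric d.

HB.instance Definition _ := Choice.on (metrized md).

Definition metric_nbhs (x : metrized md) : set (set (metrized md)) :=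
  [set A | exists2 e : R, 0 < e & [set y | d x y < e] `<=` A].

HB.instance Definition _ := hasNbhs.Build (metrized md) metric_nbhs.

Lemma metric_nbhs_filter (x : metrized md) : ProperFilter (nbhs x).
Proof.
have [_ d0 _ _] := md; split.
  by move=> [e e0 h]; apply: (h x) => /=; have [_ ->] := d0 x x.
split; first by exists 1.
- move=> A B [e e0 eA] [e' e'0 e'B]; exists (Num.min e e'); first by rewrite lt_min e0.
  by move=> y /=; rewrite lt_min => /andP[? ?]; split; [apply: eA|apply: e'B].
- by move=> A B AB [e e0 eA]; exists e => // y /eA/AB.
Qed.

Lemma metric_nbhs_singleton (x : metrized md) (A : set (metrized md)) : nbhs x A -> A x.
Proof. by have [_ d0 _ _] := md; move=> [e e0 h]; apply: h => /=; have [_ ->] := d0 x x. Qed.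

Lemma metric_nbhs_nbhs (x : metrized md) (A : set (metrized md)) :
  nbhs x A -> nbhs x (nbhs^~ A).
Proof.
have [_ _ _ dT] := md; move=> [e e0 h]; exists e => // y /= xy.
exists (e - d x y); first by rewrite subr_gt0.
move=> z /= yz; apply: h => /=; apply: le_lt_trans (dT _ y _) _.
by rewrite -ltrBrDl.
Qed.

HB.instance Definition _ := Nbhs_isNbhsTopological.Build (metrized md)
  metric_nbhs_filter metric_nbhs_singleton metric_nbhs_nbhs.

Definition metric_topology : topology_on T := Topological.class (metrized md).

End Metrized.

(** * Refining a Polish topology *)

Section Refinement.
Variable R : realType.

(** The standard ultrametric of the Baire space, normalised so that distance below [n.+1%:R^-1] is
    agreement on the first [n + 1] digits. *)
Definition baire_dist (w w' : nat -> nat) : R :=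
  if pselect (exists n, w n != w' n) is left e then (ex_minn e).+1%:R^-1 else 0.

Lemma baire_distP w w' : (w = w' /\ baire_dist w w' = 0) \/
  exists m, [/\ baire_dist w w' = m.+1%:R^-1, w m <> w' m & agree m w w'].
Proof.
rewrite /baire_dist; case: pselect => [e|n]; [right|left].
  case: ex_minnP => m /eqP wm mmin; exists m; split=> // i im.
  by apply/eqP; apply: contraTT im => /mmin; rewrite -leqNgt.
by split=> //; apply/funext => i; apply/eqP; apply: contrapT => h; apply: n; exists i; apply/negP.
Qed.

Lemma baire_dist_ge w w' m : w m <> w' m -> m.+1%:R^-1 <= baire_dist w w'.
Proof.
have [[-> //]|[n [-> _ a]] wm] := baire_distP w w'.
rewrite lef_pV2 ?posrE ?ltr0n // ler_nat ltnS leqNgt; apply/negP => /a.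
exact: wm.
Qed.

Lemma baire_dist_lt w w' n : baire_dist w w' < n.+1%:R^-1 <-> agree n.+1 w w'.
Proof.
split=> [lt i|a].
  rewrite ltnS => ni; apply: contrapT => /baire_dist_ge ge.
  have := le_lt_trans ge lt; rewrite ltf_pV2 ?posrE ?ltr0n // ltr_nat ltnS.
  by rewrite ltnNge ni.
have [[_ ->]|[m [-> wm _]]] := baire_distP w w'; first by rewrite invr_gt0 ltr0n.
rewrite ltf_pV2 ?posrE ?ltr0n // ltr_nat ltnS ltnNge; apply/negP => mn.
by apply: wm; apply: a; rewrite ltnS.
Qed.

Lemma baire_dist_ge0 w w' : 0 <= baire_dist w w'.
Proof. by have [[_ ->]|[m [-> _ _]]] := baire_distP w w'; rewrite // invr_ge0. Qed.

Lemma baire_dist_metric : is_metric baire_dist.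
Proof.
split; first exact: baire_dist_ge0.
- move=> w w'; have [[-> ->] //|[m [-> wm _]]] := baire_distP w w'.
  by split=> [/eqP|e]; [rewrite invr_eq0 pnatr_eq0|rewrite e in wm].
- have le w w' : baire_dist w w' <= baire_dist w' w.
    have [[_ ->]|[m [-> wm _]]] := baire_distP w w'; first exact: baire_dist_ge0.
    by apply: baire_dist_ge => e; apply: wm.
  by move=> w w'; apply/eqP; rewrite eq_le !le.
- move=> w w' w''; have [[_ ->]|[m [-> wm _]]] := baire_distP w w''.
    by rewrite addr_ge0 // baire_dist_ge0.
  have [e|ne] := eqVneq (w m) (w' m).
    apply: le_trans (_ : _ <= baire_dist w' w'') _; last by rewrite lerDr baire_dist_ge0.
    by apply: baire_dist_ge; rewrite -e.
  apply: le_trans (_ : _ <= baire_dist w w') _; last by rewrite lerDl baire_dist_ge0.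
  by apply: baire_dist_ge; apply/eqP.
Qed.

(* The topology of the graph of [g], which is closed in the product of [X] with the
   Baire space. *)
Lemma polish_refinement (X : topologicalType) (g : X -> nat -> nat) : polish R X -> X ->
  (forall (u : nat -> X) x w, u @ \oo --> x ->
    (forall k, exists N, forall n, (N <= n)%N -> g (u n) k = w k) -> w = g x) ->
  exists s : topology_on X, [/\ finer s, polish R (with_topology s) &
    forall x k, @nbhs (with_topology s) (with_topology s) x [set y | g y k = g x k]].
Proof.
move=> pX x0 clg; have [d [q [md cd kd dq]]] := polish_dense_seq pX x0.
pose d' x y := d x y + baire_dist (g x) (g y).
have [dge0 d0 dC dT] := md; have [_ b0 bC bT] := baire_dist_metric.
have le_d x y : d x y <= d' x y by rewrite lerDl baire_dist_ge0.
have le_b x y : baire_dist (g x) (g y) <= d' x y by rewrite lerDr.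
have md' : is_metric d'.
  split.
  - by move=> x y; rewrite addr_ge0 ?baire_dist_ge0.
  - move=> x y; split=> [e|->]; last by rewrite /d' (d0 y y).2 // (b0 _ _).2 // addr0.
    by apply/d0/eqP; rewrite eq_le dge0 andbT -e.
  - by move=> x y; rewrite /d' dC bC.
  - by move=> x y z; rewrite /d' addrACA lerD.
have small_d' x y j e : d x y < j.+1%:R^-1 -> agree j.+1 (g x) (g y) ->
    j.+1%:R^-1 + j.+1%:R^-1 < e -> d' x y < e.
  by move=> dj /baire_dist_lt bj; apply: lt_trans; apply: ltrD.
exists (metric_topology md'); split.
- move=> U; rewrite !openE => oU x /oU /cd[e e0 eU].
  by exists e => // y /= ye; apply: eU; apply: le_lt_trans (le_d _ _) ye.
- split.
    (* For each [q i], radius and finite word, a point near [q i] whose value under [g] starts with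
       the word; [x0] is the default if there is none. *)
    pose r (p : nat * nat * seq nat) := xget x0
      [set x | d x (q p.1.1) < p.1.2.+1%:R^-1 /\ mkseq (g x) (size p.2) = p.2].
    exists (range r); first exact: card_le_trans (card_image_le _ _) (countableP _).
    move=> O [x Ox]; rewrite openE => /(_ x Ox)[e e0 eO].
    have [j je] := small_inv e0.
    have [k kj] : exists k, k.+1%:R^-1 + k.+1%:R^-1 < j.+1%:R^-1 :> R.
      by apply: small_inv; rewrite invr_gt0 ltr0n.
    have [i xi] : exists i, d x (q i) < k.+1%:R^-1 by apply: dq; rewrite invr_gt0 ltr0n.
    pose p := (i, k, mkseq (g x) j.+1).
    exists (r p); split; last by exists p.
    apply: eO => /=; rewrite /r; case: xgetP => [y _ [/= yi ey]|/(_ x) []]; last first.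
      by split; [exact: xi|rewrite /p size_map size_iota].
    apply: small_d' je; first apply: lt_trans kj.
      by apply: le_lt_trans (dT _ (q i) _) _; apply: ltrD => //; rewrite dC.
    have {}ey : mkseq (g y) j.+1 = mkseq (g x) j.+1.
      by rewrite -[in LHS](size_mkseq (g x) j.+1); exact: ey.
    move=> l lj.
    by rewrite -(nth_mkseq 0%N (g x) lj) -ey nth_mkseq.
  exists d'; split=> // u cu.
  have [|x ux] := kd u.
    move=> e /cu[N hN]; exists N => m n Nm Nn.
    exact: le_lt_trans (le_d _ _) (hN m n Nm Nn).
  have cg j : exists N, forall m n, (N <= m)%N -> (N <= n)%N -> agree j.+1 (g (u m)) (g (u n)).
    have [|N hN] := cu j.+1%:R^-1; first by rewrite invr_gt0 ltr0n.
    by exists N => m n Nm Nn; apply/baire_dist_lt; apply: le_lt_trans (le_b _ _) (hN m n Nm Nn).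
  have /choice[N NP] := cg.
  have gx : (fun k => g (u (N k)) k) = g x.
    by apply: (clg u) => // k; exists (N k) => n Nn; apply: (NP k).
  exists x => A /= [e e0 eA]; have [j je] := small_inv e0.
  have nB : nbhs (x : X) [set y : X | d x y < j.+1%:R^-1].
    by apply/(cd x); exists j.+1%:R^-1; rewrite // invr_gt0 ltr0n.
  have [M _ hM] := ux _ nB.
  exists (maxn M (N j)) => // n; rewrite /= geq_max => /andP[Mn Nn]; apply: eA => /=.
  apply: small_d' je; first exact: hM.
  move=> i ij; rewrite -gx.
  have := NP j n (maxn n (N i)) Nn; rewrite (leq_trans Nn) ?leq_maxl // => /(_ isT i ij) ->.
  by apply: (NP i) => //; rewrite leq_maxr.
- move=> x k; exists k.+1%:R^-1; first by rewrite invr_gt0 ltr0n.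
  move=> y /= xy; apply/esym.
  by move: (le_lt_trans (le_b _ _) xy) => /baire_dist_lt; apply.
Qed.

End Refinement.

(** * Minimality *)

Definition tail (x : nat -> bool) : nat -> bool := fun i => x i.+1.

Lemma prependK b a : tail (prepend [:: b] a) = a.
Proof. by apply/funext => i; rewrite /tail prepend1_S. Qed.

Lemma agree_tail n x y : agree n.+1 x y -> agree n (tail x) (tail y).
Proof. by move=> a i ni; apply: a. Qed.

Lemma U0_tail x y : U0 (x, y) <->
  [/\ ~~ x 0%N, y 0%N & exists n, edge n (tail x) (tail y) \/ edge n (tail y) (tail x)] \/
  [/\ x 0%N, ~~ y 0%N & exists n, edge n (tail x) (tail y)].
Proof.
rewrite U0E; split=> [[a [b [[-> -> h]|[-> -> h]]]]|h]; rewrite ?prependK.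
- by left.
- by right.
exists (tail x), (tail y); have ex := prepend1_eta x; have ey := prepend1_eta y.
case: h => -[x0 y0 h]; [left|right]; split=> //.
- by rewrite (negbTE x0) in ex.
- by rewrite y0 in ey.
- by rewrite x0 in ex.
- by rewrite (negbTE y0) in ey.
Qed.

(** Approximations agreeing past a place [i] where [a] and [b] differ can only be edges flipping bit
    [i], so [G0] is closed off the diagonal. *)
Lemma G0_closure a b : a <> b ->
  (forall N, exists a' b', [/\ agree N a' a, agree N b' b & exists n, edge n a' b']) ->
  exists n, edge n a b.
Proof.
move=> ab h.
have [i abi] : exists i, a i <> b i.
  by apply: contrapT => n; apply: ab; apply/funext => i; apply: contrapT => ni; apply: n; exists i.
have {}h N : (i < N)%N -> exists a' b', [/\ agree N a' a, agree N b' b & edge i a' b'].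
  move=> iN; have [a' [b' [aa bb [n e]]]] := h N; exists a', b'; split=> //.
  rewrite (_ : i = n) //; apply: contrapT => /eqP/negbTE ni; apply: abi.
  by rewrite -aa // -bb //; case: e => _ _ ->; rewrite /flip ni.
have [a' [b' [aa bb [sa ai _]]]] := h i.+1 (ltnSn i).
exists i; split; last 1 first.
- apply/funext => j; have [|a1 [b1 [aa1 bb1 [_ _ e]]]] := h (maxn i j).+1.
    by rewrite ltnS leq_maxl.
  by rewrite -bb1 ?ltnS ?leq_maxr // e /flip aa1 // ltnS leq_maxr.
- by move=> j ji; rewrite -aa ?sa // ltnW.
- by rewrite -aa.
Qed.

Section Minimality.
Variables (R : realType) (X : topologicalType) (S : set (X * X)) (f : X -> cantor_space).
Hypotheses (pX : polish R X) (fcont : continuous f)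
  (fS : forall x y, U0 (f x, f y) <-> S (x, y)).

Definition doubled_points : set (nat -> bool) :=
  [set a | exists x y, f x = prepend [:: false] a /\ f y = prepend [:: true] a].

Lemma cvg_agree (u : nat -> X) x n : u @ \oo --> x ->
  exists N, forall m, (N <= m)%N -> agree n (f (u m)) (f x).
Proof.
move=> ux; have [N _ hN] := ux _ (fcont (nbhs_agree (f x) n)).
by exists N => m /hN.
Qed.

(** [g x] lists the codes of [tail (f x)] for all covering sets, so refining by [g] makes their
    preimages clopen; one refinement serves on both sides. A limit of [S] with distinct tails is
    handled by [G0_closure], and one with equal tails is excluded by independence. *)
Lemma small_pot_closed (x0 : X) : small [::] doubled_points -> pot_closed R S.
Proof.
move=> [I [c [cP cover]]].
have /choice[z zP] i : exists z : (nat -> bool) -> seq nat -> nat, exists V : set nat,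
    closedR (fun x w => w = z x) /\ forall x, (c i).2 x <-> V (z x [::]).
  by have [_ cB _] := cP i.
have [V zV] := choice zP.
pose dec n : option (I * seq nat) := unpickle n.
pose g (x : X) n := if dec n is Some p then z p.1 (tail (f x)) p.2 else 0%N.
have [u x w ux uw|s [fs ps gs]] := @polish_refinement R X g pX x0.
  have zw i : (fun l => w (pickle (i, l))) = z i (tail (f x)).
    have [cz _] := zV i; apply: (cz _) => N L.
    have [N0 hN0] := cvg_agree N.+1 ux.
    have /choice[N1 hN1] := uw.
    pose M := maxn N0 (\max_(l <- L) N1 (pickle (i, l))).
    exists (tail (f (u M))), (z i (tail (f (u M)))); split=> //.
      by apply: agree_tail; apply: hN0; apply: leq_maxl.
    move=> l lL; rewrite -(hN1 _ M) /g /dec ?pickleK //.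
    rewrite leq_max; apply/orP; right.
    exact: (@leq_bigmax_seq _ L xpredT (fun l => N1 (pickle (i, l)))).
  apply/funext => n; rewrite /g.
  have [N hN] := uw n.
  have [[[i l]] e|e] : (exists p, dec n = Some p) \/ dec n = None.
  - by case: (dec n) => [p|]; [left; exists p|right].
  (* The number [n] may differ from [pickle (i, l)] although it decodes to that pair, so the entries
     at both numbers are compared. *)
  - have := hN N (leqnn _); rewrite /g e /= => <-.
    have [N' hN'] := uw (pickle (i, l)).
    have := congr1 (@^~ l) (zw i); rewrite /= => <-.
    have := hN (maxn N N') (leq_maxl _ _); rewrite /g e /= => wn.
    have := hN' (maxn N N') (leq_maxr _ _); rewrite /g /dec pickleK /= wn => <-.
    by have := hN N (leqnn _); rewrite /g e.
  - by have := hN N (leqnn _); rewrite /g e.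
exists s, s; split=> // -[x y] cl.
have near N k : exists x' y', [/\ S (x', y'), agree N (f x') (f x), agree N (f y') (f y),
    g x' k = g x k & g y' k = g y k].
  have nb (t : X) : @nbhs (with_topology s) (with_topology s) t
      [set t' | agree N (f t') (f t) /\ g t' k = g t k].
    have n1 : nbhs t [set t' | agree N (f t') (f t)] := fcont (nbhs_agree (f t) N).
    have n2 := finer_nbhs fs n1.
    exact: (@filterI _ _ (nbhs_filter (t : with_topology s)) _ _ n2 (gs t k)).
  have [|[x' y'] [/= Sxy [[ax gx] [ay gy]]]] := cl
     ([set t' | agree N (f t') (f x) /\ g t' k = g x k] `*`
      [set t' | agree N (f t') (f y) /\ g t' k = g y k]).
    by exists ([set t' | agree N (f t') (f x) /\ g t' k = g x k],
      [set t' | agree N (f t') (f y) /\ g t' k = g y k]) => //; split; apply: nb.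
  by exists x', y'.
apply/fS/U0_tail.
set a := tail (f x); set b := tail (f y).
have ex : f x = prepend [:: f x 0%N] a := prepend1_eta _.
have ey : f y = prepend [:: f y 0%N] b := prepend1_eta _.
have BE i x' x'' :
    g x' (pickle (i, [::] : seq nat)) = g x'' (pickle (i, [::] : seq nat)) ->
    (c i).2 (tail (f x'')) -> (c i).2 (tail (f x')).
  by have [_ BV] := zV i; rewrite /g /dec pickleK /= => e /BV Vb; apply/BV; rewrite e.
have ab : a <> b.
  move=> ab; have ey' := ey; rewrite -ab in ey'.
  (* Equal tails make [a] a doubled point, since the first digits of [f x] and [f y] differ. *)
  have [i Bi] : exists i, (c i).2 a.
    apply: cover; have [x' [y' [/fS/U0_tail h ax ay _ _]]] := near 1%N 0%N.
    rewrite !ax // !ay // in h; case: h => -[x1 y1 _]; [exists x, y|exists y, x].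
      by split; [rewrite [LHS]ex (negbTE x1)|rewrite [LHS]ey' y1].
    by split; [rewrite [LHS]ey' (negbTE y1)|rewrite [LHS]ex x1].
  (* Close to [(x, y)] both tails stay in the same independent set, yet they are joined by an
     edge. *)
  have [x' [y' [/fS/U0_tail h ax ay gx gy]]] := near 1%N (pickle (i, [::] : seq nat)).
  have Bx := BE _ _ _ gx Bi; rewrite ab in Bi; have By := BE _ _ _ gy Bi.
  have [_ _ ind] := cP i.
  by case: h => -[_ _ [n]] => [[]|] e; apply: (ind _ _ _ e).
have ba : b <> a by move=> e; apply: ab.
have [x' [y' [/fS/U0_tail h ax ay _ _]]] := near 1%N 0%N.
rewrite !ax // !ay // in h; case: h => -[x1 y1 _]; [left|right]; split=> //; last first.
  apply: G0_closure => // N; have [x2 [y2 [/fS/U0_tail h ax2 ay2 _ _]]] := near N.+1 0%N.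
  rewrite !ax2 // !ay2 // x1 (negbTE y1) in h.
  exists (tail (f x2)), (tail (f y2)); split; [exact: agree_tail|exact: agree_tail|].
  by case: h => -[].
(* With first digits 0 and 1, edges of both orientations are allowed: either one orientation occurs
   at all scales, or beyond some [N0] only the other is left. *)
have [h|h] := pselect (forall N, exists a' b',
    [/\ agree N a' a, agree N b' b & exists n, edge n a' b']).
  by have [n e] := G0_closure ab h; exists n; left.
have [N0 nN0] : exists N0, ~ exists a' b',
    [/\ agree N0 a' a, agree N0 b' b & exists n, edge n a' b'].
  by apply: contrapT => n; apply: h => N; apply: contrapT => nN; apply: n; exists N.
have [|n e] := G0_closure ba; last by exists n; right.
move=> N; have [x2 [y2 [/fS/U0_tail h2 ax2 ay2 _ _]]] := near (maxn N N0).+1 0%N.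
have [aN aN0] := agree_maxn (agree_tail ax2); have [bN bN0] := agree_maxn (agree_tail ay2).
exists (tail (f y2)), (tail (f x2)); split=> //.
rewrite !ax2 // !ay2 // y1 (negbTE x1) in h2; case: h2 => -[] // _ _ [n [e|e]]; last by exists n.
by case: nN0; exists (tail (f x2)), (tail (f y2)); split=> //; exists n.
Qed.

(** [G0_embedding] is applied to a relation whose witnesses code pairs of points of [X] above [0a]
    and [1a]; decoding the selected witnesses is continuous and gives the reduction. *)
Lemma large_cred : injective f -> X -> ~ small [::] doubled_points -> cred U0 S.
Proof.
move=> finj x0 large.
have [d [q [md cd kd dq]]] := polish_dense_seq pX x0.
(* Even entries of [w] code the point above [0a], odd entries the point above [1a]. *)
pose codes x b (w : nat -> nat) := rep d q x (fun j => w (j.*2 + b)%N).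
pose Gam (a : nat -> bool) w := exists x y,
  [/\ f x = prepend [:: false] a, f y = prepend [:: true] a, codes x 0%N w & codes y 1%N w].
have cG : closedR Gam.
  move=> a w h.
  have /choice[u uP] N : exists p : X * X, exists a', [/\ agree N a' a,
      f p.1 = prepend [:: false] a', f p.2 = prepend [:: true] a',
      forall j, (j < N)%N -> d p.1 (q (w (j.*2 + 0)%N)) <= j.+1%:R^-1 &
      forall j, (j < N)%N -> d p.2 (q (w (j.*2 + 1)%N)) <= j.+1%:R^-1].
    have [a' [w' [aa wl [x [y [fx fy cx cy]]]]]] := h N (iota 0 N.*2).
    exists (x, y), a'; split=> // j jN; rewrite -wl ?mem_iota //=.
      by rewrite addn0 ltn_double.
    by rewrite addn1 add0n -ltn_half_double /= uphalf_double.
  have [|x [ux rx]] := @rep_limit R X d q (fun N => (u N).1) (fun j => w (j.*2 + 0)%N) md cd kd.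
    by move=> N; have [a' []] := uP N.
  have [|y [uy ry]] := @rep_limit R X d q (fun N => (u N).2) (fun j => w (j.*2 + 1)%N) md cd kd.
    by move=> N; have [a' []] := uP N.
  have lim b (v : nat -> X) t : v @ \oo --> t -> (forall N, exists a', agree N a' a /\
      f (v N) = prepend [:: b] a') -> f t = prepend [:: b] a.
    move=> vt hv; apply/funext => i; have [N hN] := cvg_agree i.+1 vt.
    rewrite -(hN (maxn N i)) ?leq_maxl //.
    have [a' [aa ->]] := hv (maxn N i); apply: (proj2 (agree_prepend1 b _ _ _) aa).
    by rewrite ltnS leq_maxr.
  exists x, y; split=> //.
    by apply: lim ux _ => N; have [a' []] := uP N; exists a'.
  by apply: lim uy _ => N; have [a' []] := uP N; exists a'.
have largeG : ~ small [::] [set a | exists w, Gam a w].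
  apply: contra_not large; apply: small_subset => a [x [y [fx fy]]].
  have [w r] := rep_exists x dq; have [w' r'] := rep_exists y dq.
  exists (fun i => if odd i then w' i./2 else w i./2), x, y; split=> // j.
    by rewrite addn0 odd_double doubleK.
  by rewrite addn1 /= odd_double /= uphalf_double.
have [a [W [GW Wloc ainj aedge]]] := G0_embedding cG largeG.
have /choice[p pP] (c : nat -> bool) : exists x,
    f x = prepend [:: c 0%N] (a (tail c)) /\ codes x (c 0%N) (W (tail c)).
  by have [x [y [fx fy cx cy]]] := GW (tail c); case: (c 0%N); [exists y|exists x].
have fp c : f (p c) = prepend [:: c 0%N] (a (tail c)) by have [] := pP c.
exists p; split.
- move=> c c' /(congr1 f); rewrite !fp => e.
  have e0 : c 0%N = c' 0%N by have := congr1 (@^~ 0%N) e.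
  have /ainj et : a (tail c) = a (tail c') by rewrite -(prependK (c 0%N) (a _)) e prependK.
  by rewrite (prepend1_eta c) (prepend1_eta c') e0 -/(tail c) et.
- move=> c A /cd[e e0 eA]; have [j je] := small_inv e0.
  (* Entry [j.*2 + c 0] of the witness depends on at most [j.*2 + 2] digits of [tail c], that is on
     [j.*2 + 3] digits of [c]. *)
  apply: filterS (nbhs_agree c j.*2.+3) => c' ac; apply: eA => /=.
  have [_ r] := pP c; have [_ r'] := pP c'.
  have e00 : c' 0%N = c 0%N by apply: ac.
  apply: le_lt_trans je.
  apply: (@rep_dist R X d q (p c) (p c') (fun j => W (tail c) (j.*2 + c 0%N)%N)
    (fun j => W (tail c') (j.*2 + c' 0%N)%N) j md (r j) (r' j)).
  rewrite e00; apply: Wloc => i ij; rewrite /tail ac // ltnS.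
  by apply: leq_trans ij _; case: (c 0%N); rewrite ?addn1 ?addn0.
- move=> x y.
  have aE u v : (exists n, edge n (a u) (a v)) = (exists n, edge n u v).
    by apply/propext; rewrite -aedge.
  have orE u v : (exists n, edge n u v \/ edge n v u) =
      ((exists n, edge n u v) \/ (exists n, edge n v u)).
    by apply/propext; split=> [[n [h|h]]|[[n h]|[n h]]];
      [left|right| |]; exists n => //; [left|right].
  by rewrite -fS !U0_tail !fp !prependK !prepend1_0 !orE !aE.
Qed.

End Minimality.

Theorem theorem7p12 (R : realType) : minimal_non_pot_closed R U0.
Proof.
split; first exact: U0_not_pot_closed.
move=> X S pX nS [f [finj fcont fS]].
have [[x0]|nX] := pselect (inhabited X); last first.
  (* The empty space is set apart, since coding by a dense sequence needs a point; there every
     relation is closed. *)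
  case: nS; exists (Topological.class X), (Topological.class X).
  by split=> // -[x]; case: nX.
by apply: (large_cred pX fcont fS finj x0) => /(small_pot_closed pX fcont fS x0).
Qed.
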